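(* Let $(R,\mathfrak{m})$ be a commutative Noetherian local ring and let $E = E_R(R/\mathfrak{m})$ be the injective hull of its residue field. Let $\mathfrak{p} \in \operatorname{Spec} R$ be a prime ideal with $\dim R/\mathfrak{p} = 1$. Then $\operatorname{Hom}_R(E_R(R/\mathfrak{p}), E) \simeq \widehat{R_{\mathfrak{p}}}$ (i.e. $\operatorname{Hom}_R(E_R(R/\mathfrak{p}), E)$ is the completion of a free $R_{\mathfrak{p}}$-module of rank one) if and only if $R/\mathfrak{p}$ is complete.
   Context: $E_R(M)$ denotes the injective hull of an $R$-module $M$. $\widehat{R_{\mathfrak{p}}}$ denotes the completion of the local ring $R_{\mathfrak{p}}$ with respect to its maximal ideal $\mathfrak{p}R_{\mathfrak{p}}$. The local ring $R/\mathfrak{p}$ is called complete if it is complete in the topology of its maximal ideal $\mathfrak{m}/\mathfrak{p}$. The isomorphism is an isomorphism of $R$-modules. *)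

(* Defs.v *)
From HB Require Import structures.
From mathcomp Require Import all_boot all_algebra generic_quotient ring_quotient.
From mathcomp Require Import boolp classical_sets functions ring.

Set Implicit Arguments.
Unset Strict Implicit.
Unset Printing Implicit Defensive.

Import GRing.Theory.
Local Open Scope ring_scope.
Local Open Scope quotient_scope.

(* An [idealr R] is a proper ideal of R, given by a bool-valued predicate;      *)
(* [`[< P >]] turns any proposition into a bool, so no ideal is excluded.       *)

(* The unit ideal, which is not an [idealr], is generated by 1. *)
Definition noetherian (R : comNzRingType) : Prop :=
  forall I : idealr R, exists (n : nat) (g : 'I_n -> R),
    forall x, x \in (I : pred R) <-> exists c : 'I_n -> R, x = \sum_i c i * g i.

Definition maximal_ideal (R : comNzRingType) (m : idealr R) : Prop :=
  forall I : idealr R,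
    {subset (m : pred R) <= (I : pred R)} -> (I : pred R) =i (m : pred R).

Definition local_ring (R : comNzRingType) (m : idealr R) : Prop :=
  maximal_ideal m /\
  forall m' : idealr R, maximal_ideal m' -> (m' : pred R) =i (m : pred R).

Definition prime_chain (R : comNzRingType) (n : nat) : Prop :=
  exists q : nat -> prime_idealr R, forall i, (i < n)%N ->
    {subset (q i : pred R) <= (q i.+1 : pred R)} /\
    ~ {subset (q i.+1 : pred R) <= (q i : pred R)}.

Definition krull_dim_eq (R : comNzRingType) (d : nat) : Prop :=
  prime_chain R d /\ forall n, prime_chain R n -> (n <= d)%N.

Section Ideals.
Variable A : comNzRingType.

(* The power of I with exponent 0 is the whole ring. *)
Definition ideal_pow (I : {pred A}) (n : nat) : pred A := fun x =>
  `[< exists (k : nat) (a : 'I_k -> A) (u : 'I_k -> 'I_n -> A),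
        (forall i j, u i j \in I) /\ x = \sum_i a i * \prod_j u i j >].

Definition ideal_ext (B : comNzRingType) (f : {rmorphism A -> B})
    (I : {pred A}) : pred B := fun y =>
  `[< exists (k : nat) (b : 'I_k -> B) (a : 'I_k -> A),
        (forall i, a i \in I) /\ y = \sum_i b i * f (a i) >].

Definition adic_cauchy (I : {pred A}) (x : nat -> A) : Prop :=
  forall n, exists N, forall i j, (N <= i)%N -> (N <= j)%N ->
    x i - x j \in ideal_pow I n.

Definition adic_cvg (I : {pred A}) (x : nat -> A) (l : A) : Prop :=
  forall n, exists N, forall i, (N <= i)%N -> x i - l \in ideal_pow I n.

(* Uniqueness of limits says that the topology is Hausdorff. *)
Definition adic_complete (I : {pred A}) : Prop :=
  forall x, adic_cauchy I x -> exists! l, adic_cvg I x l.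

Section PowTheory.
Variable I : {pred A}.

Lemma ideal_pow_0 n : 0 \in ideal_pow I n.
Proof.
apply/asboolP; exists 0%N, (fun=> 0), (fun _ _ => 0).
by split=> [[]//|]; rewrite big_ord0.
Qed.

Lemma ideal_powD n x y :
  x \in ideal_pow I n -> y \in ideal_pow I n -> x + y \in ideal_pow I n.
Proof.
move=> /asboolP [k [a [u [uI ->]]]] /asboolP [l [b [v [vI ->]]]].
apply/asboolP; exists (k + l)%N.
exists (fun i => match fintype.split i with inl j => a j | inr j => b j end).
exists (fun i => match fintype.split i with inl j => u j | inr j => v j end).
split=> [i j|]; first by case: fintype.split => ?; [apply: uI|apply: vI].
rewrite big_split_ord /=; congr (_ + _); apply: eq_bigr => i _.
  by rewrite (unsplitK (inl i)).
by rewrite (unsplitK (inr i)).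
Qed.

Lemma ideal_powMl n x y : y \in ideal_pow I n -> x * y \in ideal_pow I n.
Proof.
move=> /asboolP [k [a [u [uI ->]]]]; apply/asboolP.
exists k, (fun i => x * a i), u; split=> //.
by rewrite mulr_sumr; apply: eq_bigr => i _; rewrite mulrA.
Qed.

Lemma ideal_powMr n x y : x \in ideal_pow I n -> x * y \in ideal_pow I n.
Proof. by rewrite mulrC; apply: ideal_powMl. Qed.

Lemma ideal_powN n x : x \in ideal_pow I n -> - x \in ideal_pow I n.
Proof. by move=> xI; rewrite -mulN1r ideal_powMl. Qed.

Lemma ideal_powB n x y :
  x \in ideal_pow I n -> y \in ideal_pow I n -> x - y \in ideal_pow I n.
Proof. by move=> xI yI; rewrite ideal_powD ?ideal_powN. Qed.

End PowTheory.

Lemma ideal_pow1_sub (I : idealr A) x :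
  x \in ideal_pow (I : pred A) 1 -> x \in (I : pred A).
Proof.
move=> /asboolP [k [a [u [uI ->]]]]; apply: rpred_sum => i _.
by rewrite big_ord1 idealMr ?uI.
Qed.

End Ideals.

(* The completion of A in the I-adic topology: Cauchy sequences modulo null     *)
(* sequences.                                                                   *)
Section Completion.
Variables (A : comNzRingType) (I : idealr A).
Local Notation J := (I : pred A).


Definition cauchy_seq_pred : pred (nat -> A) := fun x => `[< adic_cauchy J x >].

Lemma cauchy_seq_subring : subring_closed cauchy_seq_pred.
Proof.
split=> [|x y /asboolP xC /asboolP yC|x y /asboolP xC /asboolP yC].
- by apply/asboolP => n; exists 0%N => i j _ _; rewrite subrr ideal_pow_0.
- apply/asboolP => n; have [N xN] := xC n; have [M yM] := yC n.
  exists (maxn N M) => i j; rewrite !geq_max => /andP[Ni Mi] /andP[Nj Mj].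
  have -> : (x - y) i - (x - y) j = (x i - x j) - (y i - y j).
    have E (a b c d : A) : (a - b) - (c - d) = (a - c) - (b - d) by ring.
    exact: E.
  by rewrite ideal_powB ?xN ?yM.
- apply/asboolP => n; have [N xN] := xC n; have [M yM] := yC n.
  exists (maxn N M) => i j; rewrite !geq_max => /andP[Ni Mi] /andP[Nj Mj].
  have -> : (x * y) i - (x * y) j = (x i - x j) * y i + x j * (y i - y j).
    have E (a b c d : A) : a * b - c * d = (a - c) * b + c * (b - d) by ring.
    exact: E.
  by apply: ideal_powD; [apply/ideal_powMr/xN|apply/ideal_powMl/yM].
Qed.

HB.instance Definition _ :=
  GRing.isSubringClosed.Build (nat -> A) cauchy_seq_pred cauchy_seq_subring.

Record cauchy_seq :=
  CauchySeq { seq_val :> nat -> A; _ : seq_val \in cauchy_seq_pred }.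

HB.instance Definition _ := [isSub for seq_val].
HB.instance Definition _ := [Choice of cauchy_seq by <:].
HB.instance Definition _ := [SubChoice_isSubComNzRing of cauchy_seq by <:].

Definition null_seq : pred cauchy_seq := fun x => `[< adic_cvg J (val x) 0 >].

Lemma null_seq_idealr : idealr_closed null_seq.
Proof.
split=> [||a x y /asboolP x0 /asboolP y0].
- by apply/asboolP => n; exists 0%N => i _; rewrite subr0 ideal_pow_0.
- apply/negP => /asboolP /(_ 1%N) [N /(_ _ (leqnn N))]; rewrite subr0.
  by move=> /ideal_pow1_sub; rewrite /= [X in X \in _]/(1 : A) idealr1.
- have /asboolP aC := valP a.
  apply/asboolP => n; have [N xN] := x0 n; have [M yM] := y0 n.
  exists (maxn N M) => i; rewrite geq_max => /andP[Ni Mi].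
  have xi := xN _ Ni; have yi := yM _ Mi; rewrite !subr0 in xi yi *.
  by rewrite ideal_powD ?ideal_powMl.
Qed.

HB.instance Definition _ := isIdealr.Build cauchy_seq null_seq null_seq_idealr.

Definition null_ideal : idealr cauchy_seq := null_seq.

Definition completion := {ideal_quot null_ideal}.
HB.instance Definition _ := GRing.ComNzRing.on completion.

Lemma cst_cauchy (a : A) : (fun=> a) \in cauchy_seq_pred.
Proof. by apply/asboolP => n; exists 0%N => i j _ _; rewrite subrr ideal_pow_0. Qed.

Definition cst_seq (a : A) : cauchy_seq := Sub (fun=> a) (cst_cauchy a).

Definition to_completion (a : A) : completion := \pi_{ideal_quot null_ideal} (cst_seq a).

Lemma to_completion_zmod : zmod_morphism to_completion.
Proof.
move=> a b; rewrite -[RHS](rmorphB \pi_{ideal_quot null_ideal}).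
by congr (\pi _); apply: val_inj.
Qed.

Lemma to_completion_monoid : monoid_morphism to_completion.
Proof.
split=> [|a b].
  by rewrite -[RHS](rmorph1 \pi_{ideal_quot null_ideal}); congr (\pi _); apply: val_inj.
by rewrite -[RHS](rmorphM \pi_{ideal_quot null_ideal}); congr (\pi _); apply: val_inj.
Qed.

HB.instance Definition _ :=
  GRing.isZmodMorphism.Build A completion to_completion to_completion_zmod.
HB.instance Definition _ :=
  GRing.isMonoidMorphism.Build A completion to_completion to_completion_monoid.

End Completion.

Arguments to_completion {A} I a.

(* R localized at p: pairs (a, s), standing for a / s with s not in p. *)
Section Localization.
Variables (R : comNzRingType) (p : prime_idealr R).
Local Notation P := (p : pred R).

Definition denom := {s : R | s \notin P}.
Local Notation fracs := (R * denom)%type.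
Implicit Types x y z : fracs.

Lemma denom1_subproof : 1 \notin P. Proof. by rewrite idealr1. Qed.
Definition denom1 : denom := Sub 1 denom1_subproof.

Lemma denomM_subproof (s t : denom) : val s * val t \notin P.
Proof. by rewrite prime_idealrM negb_or (valP s) (valP t). Qed.
Definition denomM (s t : denom) : denom := Sub (val s * val t) (denomM_subproof s t).

Definition loc_equiv x y : bool :=
  `[< exists u : denom, val u * (x.1 * val y.2 - y.1 * val x.2) = 0 >].

Lemma loc_equivP x y : reflect
  (exists u : denom, val u * (x.1 * val y.2) = val u * (y.1 * val x.2))
  (loc_equiv x y).
Proof.
apply: (iffP (asboolP _)) => -[u]; exists u.
  by apply/eqP; rewrite -subr_eq0 -mulrBr; apply/eqP.
by rewrite mulrBr; apply/eqP; rewrite subr_eq0; apply/eqP.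
Qed.

Lemma loc_equiv_refl : reflexive loc_equiv.
Proof. by move=> x; apply/loc_equivP; exists denom1. Qed.

Lemma loc_equiv_sym : symmetric loc_equiv.
Proof. by move=> x y; apply/loc_equivP/loc_equivP => -[u]; exists u. Qed.

Lemma loc_equiv_trans : transitive loc_equiv.
Proof.
move=> y x z /loc_equivP[u ux] /loc_equivP[v vy]; apply/loc_equivP.
exists (denomM (denomM u v) y.2) => /=.
have E (a b c u' v' s t w : R) : u' * (a * t) = u' * (b * s) ->
    v' * (b * w) = v' * (c * t) ->
    u' * v' * t * (a * w) = u' * v' * t * (c * s).
  clear; move=> ux vy.
  have -> : u' * v' * t * (a * w) = u' * (a * t) * (v' * w) by ring.
  rewrite ux; have -> : u' * (b * s) * (v' * w) = v' * (b * w) * (u' * s) by ring.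
  by rewrite vy; ring.
exact: E ux vy.
Qed.

Canonical loc_equiv_equiv :=
  EquivRel loc_equiv loc_equiv_refl loc_equiv_sym loc_equiv_trans.

Definition localization := {eq_quot loc_equiv}.
HB.instance Definition _ : EqQuotient _ loc_equiv localization :=
  EqQuotient.on localization.
HB.instance Definition _ := Choice.on localization.

Lemma loc_eqP x y : reflect
  (exists u : denom, val u * (x.1 * val y.2) = val u * (y.1 * val x.2))
  (\pi_localization x == \pi_localization y).
Proof. by rewrite eqmodE; apply: loc_equivP. Qed.

Lemma loc_reprP x : exists u : denom,
  val u * ((repr (\pi_localization x)).1 * val x.2) =
  val u * (x.1 * val (repr (\pi_localization x)).2).
Proof. by apply/loc_eqP; rewrite reprK. Qed.

Definition loc_addf x y : fracs :=
  (x.1 * val y.2 + y.1 * val x.2, denomM x.2 y.2).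
Definition loc_oppf x : fracs := (- x.1, x.2).
Definition loc_mulf x y : fracs := (x.1 * y.1, denomM x.2 y.2).

Definition loc_add := lift_op2 localization loc_addf.
Definition loc_opp := lift_op1 localization loc_oppf.
Definition loc_mul := lift_op2 localization loc_mulf.

Lemma loc_pi_add x y : loc_add (\pi_localization x) (\pi_localization y) =
  \pi_localization (loc_addf x y).
Proof.
unlock loc_add; apply/eqP/loc_eqP; have [u] := loc_reprP x; have [v] := loc_reprP y.
case: (repr _) => c' d' /=; case: (repr _) => a' b' /= vy ux.
exists (denomM u v) => /=.
have E (a b c d x1 x2 y1 y2 s t : R) :
    s * (a * x2) = s * (x1 * b) -> t * (c * y2) = t * (y1 * d) ->
    s * t * ((a * d + c * b) * (x2 * y2)) = s * t * ((x1 * y2 + y1 * x2) * (b * d)).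
  clear; move=> ux vy.
  have -> : s * t * ((a * d + c * b) * (x2 * y2)) =
    s * (a * x2) * (t * d * y2) + t * (c * y2) * (s * b * x2) by ring.
  by rewrite ux vy; ring.
exact: E ux vy.
Qed.

Lemma loc_pi_opp x : loc_opp (\pi_localization x) = \pi_localization (loc_oppf x).
Proof.
unlock loc_opp; apply/eqP/loc_eqP; have [u] := loc_reprP x.
case: (repr _) => a b /= ux; exists u.
by rewrite !mulNr !mulrN ux.
Qed.

Lemma loc_pi_mul x y : loc_mul (\pi_localization x) (\pi_localization y) =
  \pi_localization (loc_mulf x y).
Proof.
unlock loc_mul; apply/eqP/loc_eqP; have [u] := loc_reprP x; have [v] := loc_reprP y.
case: (repr _) => c' d' /=; case: (repr _) => a' b' /= vy ux.
exists (denomM u v) => /=.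
have E (a b c d x1 x2 y1 y2 s t : R) :
    s * (a * x2) = s * (x1 * b) -> t * (c * y2) = t * (y1 * d) ->
    s * t * (a * c * (x2 * y2)) = s * t * (x1 * y1 * (b * d)).
  clear; move=> ux vy.
  have -> : s * t * (a * c * (x2 * y2)) =
    s * (a * x2) * (t * (c * y2)) by ring.
  by rewrite ux vy; ring.
exact: E ux vy.
Qed.

Definition to_loc (a : R) : localization := \pi_localization (a, denom1).

Lemma loc_eq1 x y : x.1 * val y.2 = y.1 * val x.2 ->
  \pi_localization x = \pi_localization y.
Proof. by move=> xy; apply/eqP/loc_eqP; exists denom1; rewrite xy. Qed.

Lemma loc_addA : associative loc_add.
Proof.
elim/quotW=> x; elim/quotW=> y; elim/quotW=> z; rewrite !loc_pi_add.
by apply: loc_eq1 => /=; ring.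
Qed.

Lemma loc_addC : commutative loc_add.
Proof.
elim/quotW=> x; elim/quotW=> y; rewrite !loc_pi_add.
by apply: loc_eq1 => /=; ring.
Qed.

Lemma loc_add0 : left_id (to_loc 0) loc_add.
Proof. by elim/quotW=> x; rewrite loc_pi_add; apply: loc_eq1 => /=; ring. Qed.

Lemma loc_addN : left_inverse (to_loc 0) loc_opp loc_add.
Proof.
elim/quotW=> x; rewrite loc_pi_opp loc_pi_add.
by apply: loc_eq1 => /=; ring.
Qed.

HB.instance Definition _ :=
  GRing.isZmodule.Build localization loc_addA loc_addC loc_add0 loc_addN.

Lemma loc_mulA : associative loc_mul.
Proof.
elim/quotW=> x; elim/quotW=> y; elim/quotW=> z; rewrite !loc_pi_mul.
by apply: loc_eq1 => /=; ring.
Qed.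

Lemma loc_mulC : commutative loc_mul.
Proof.
elim/quotW=> x; elim/quotW=> y; rewrite !loc_pi_mul.
by apply: loc_eq1 => /=; ring.
Qed.

Lemma loc_mul1 : left_id (to_loc 1) loc_mul.
Proof. by elim/quotW=> x; rewrite loc_pi_mul; apply: loc_eq1 => /=; ring. Qed.

Lemma loc_mulDl : left_distributive loc_mul loc_add.
Proof.
elim/quotW=> x; elim/quotW=> y; elim/quotW=> z.
rewrite loc_pi_add !loc_pi_mul loc_pi_add.
by apply: loc_eq1 => /=; ring.
Qed.

Lemma loc_one_neq0 : to_loc 1 != to_loc 0.
Proof.
apply/negP => /loc_eqP [u] /=; rewrite !mulr1 mulr0 => u0.
by have /= := valP u; rewrite u0 idealr0.
Qed.

HB.instance Definition _ := GRing.Zmodule_isComNzRing.Build localization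
  loc_mulA loc_mulC loc_mul1 loc_mulDl loc_one_neq0.

Lemma to_loc_zmod : zmod_morphism to_loc.
Proof.
move=> a b.
have -> : to_loc a - to_loc b =
    \pi_localization (loc_addf (a, denom1) (loc_oppf (b, denom1))).
  by rewrite -loc_pi_add -loc_pi_opp.
by apply: loc_eq1 => /=; ring.
Qed.

Lemma to_loc_monoid : monoid_morphism to_loc.
Proof.
split=> [//|a b].
have -> : to_loc a * to_loc b = \pi_localization (loc_mulf (a, denom1) (b, denom1)).
  by rewrite -loc_pi_mul.
by apply: loc_eq1 => /=; ring.
Qed.

HB.instance Definition _ := GRing.isZmodMorphism.Build R localization to_loc to_loc_zmod.
HB.instance Definition _ :=
  GRing.isMonoidMorphism.Build R localization to_loc to_loc_monoid.

(* The maximal ideal of the localization. *)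
Definition loc_max : pred localization := ideal_ext to_loc P.

Lemma loc_maxP (a : localization) : a \in loc_max ->
  exists x : fracs, a = \pi_localization x /\ x.1 \in P.
Proof.
move=> /asboolP [k [b [c [cP ->]]]].
elim/big_ind: _ => [|_ _ [x [-> xP]] [y [-> yP]]|i _].
- by exists (0, denom1); rewrite idealr0.
- exists (loc_addf x y); split; first exact: loc_pi_add.
  by rewrite /= rpredD // mulrC idealMr.
- elim/quotW: (b i) => x; exists (loc_mulf x (c i, denom1)).
  by split; [exact: loc_pi_mul|rewrite /= idealMr ?cP].
Qed.

Lemma loc_max_idealr : idealr_closed loc_max.
Proof.
split.
- by apply/asboolP; exists 0%N, (fun=> 0), (fun=> 0); split=> [[]//|]; rewrite big_ord0.
- apply/negP => /loc_maxP [x [/eqP/loc_eqP [u] /= +] xP].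
  rewrite mul1r mulr1 => E; have : val u * val x.2 \in P by rewrite E idealMr.
  by rewrite prime_idealrM (negPf (valP u)) (negPf (valP x.2)).
- move=> a x y /asboolP [k [b [c [cP ->]]]] /asboolP [l [d [e [eP ->]]]].
  apply/asboolP; exists (k + l)%N.
  exists (fun i => match fintype.split i with inl j => a * b j | inr j => d j end).
  exists (fun i => match fintype.split i with inl j => c j | inr j => e j end).
  split=> [i|]; first by case: fintype.split => ?; [apply: cP|apply: eP].
  rewrite big_split_ord /= mulr_sumr; congr (_ + _); apply: eq_bigr => i _.
    by rewrite (unsplitK (inl i)) mulrA.
  by rewrite (unsplitK (inr i)).
Qed.

HB.instance Definition _ := isIdealr.Build localization loc_max loc_max_idealr.

End Localization.

Arguments to_loc {R} p a.
Arguments loc_max {R} p _.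

(* Restriction of scalars: S as an R-module through f : R -> S. *)
Definition restr (R S : comNzRingType) (f : {rmorphism R -> S}) : Type := S.

Section Restriction.
Variables (R S : comNzRingType) (f : {rmorphism R -> S}).

HB.instance Definition _ := GRing.Zmodule.on (restr f).

Definition restr_scale (a : R) (x : restr f) : restr f := f a * (x : S).

Lemma restr_scaleA a b x : restr_scale a (restr_scale b x) = restr_scale (a * b) x.
Proof. by rewrite /restr_scale rmorphM mulrA. Qed.
Lemma restr_scale1 : left_id 1 restr_scale.
Proof. by move=> x; rewrite /restr_scale rmorph1 mul1r. Qed.
Lemma restr_scaleDr : right_distributive restr_scale +%R.
Proof. by move=> a x y; apply: mulrDr. Qed.
Lemma restr_scaleDl x : {morph restr_scale^~ x : a b / a + b}.
Proof. by move=> a b; rewrite /restr_scale rmorphD; apply: mulrDl. Qed.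

HB.instance Definition _ := GRing.Zmodule_isLmodule.Build R (restr f)
  restr_scaleA restr_scale1 restr_scaleDr restr_scaleDl.

End Restriction.

Section Hom.
Variables (R : comNzRingType) (M N : lmodType R).

Definition module_hom : Type := {linear M -> N}.
HB.instance Definition _ := gen_eqMixin module_hom.
HB.instance Definition _ := gen_choiceMixin module_hom.
Implicit Types f g h : module_hom.

Lemma homP f g : (f : M -> N) =1 (g : M -> N) -> f = g.
Proof.
case: f g => [f [[fD] [fZ]]] [g [[gD] [gZ]]] /= /funext fg; subst g.
by rewrite (Prop_irrelevance fD gD) (Prop_irrelevance fZ gZ).
Qed.

Definition hom0 : module_hom := (\0 : M -> N).
Definition hom_opp f : module_hom := (\- f : M -> N).
Definition hom_add f g : module_hom := (f \+ g : M -> N).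
Definition hom_scale (a : R) f : module_hom := (a \*: f : M -> N).

Lemma hom_addA : associative hom_add.
Proof. by move=> f g h; apply: homP => x; apply: addrA. Qed.
Lemma hom_addC : commutative hom_add.
Proof. by move=> f g; apply: homP => x; apply: addrC. Qed.
Lemma hom_add0 : left_id hom0 hom_add.
Proof. by move=> f; apply: homP => x; apply: add0r. Qed.
Lemma hom_addN : left_inverse hom0 hom_opp hom_add.
Proof. by move=> f; apply: homP => x; apply: addNr. Qed.

HB.instance Definition _ :=
  GRing.isZmodule.Build module_hom hom_addA hom_addC hom_add0 hom_addN.

Lemma hom_scaleA a b f : hom_scale a (hom_scale b f) = hom_scale (a * b) f.
Proof. by apply: homP => x; apply: scalerA. Qed.
Lemma hom_scale1 : left_id 1 hom_scale.
Proof. by move=> f; apply: homP => x; apply: scale1r. Qed.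
Lemma hom_scaleDr : right_distributive hom_scale +%R.
Proof. by move=> a f g; apply: homP => x; apply: scalerDr. Qed.
Lemma hom_scaleDl f : {morph hom_scale^~ f : a b / a + b}.
Proof. by move=> a b; apply: homP => x; apply: scalerDl. Qed.

HB.instance Definition _ := GRing.Zmodule_isLmodule.Build R module_hom
  hom_scaleA hom_scale1 hom_scaleDr hom_scaleDl.

End Hom.

Section Modules.
Variable R : comNzRingType.

Definition module_iso (M N : lmodType R) : Prop :=
  exists f : {linear M -> N}, bijective f.

Definition injective_module (E : lmodType R) : Prop :=
  forall (A B : lmodType R) (f : {linear A -> B}) (g : {linear A -> E}),
    injective f -> exists h : {linear B -> E}, forall x, h (f x) = g x.

Definition essential_mono (M E : lmodType R) (i : {linear M -> E}) : Prop :=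
  injective i /\
  forall N : {pred E}, submod_closed N -> (exists2 x, x \in N & x != 0) ->
    exists y, i y \in N /\ i y != 0.

Definition injective_hull (M E : lmodType R) : Prop :=
  injective_module E /\ exists i : {linear M -> E}, essential_mono i.

End Modules.

(* Main.v *)
(* Write Q for the fraction field of R/p, embedded in E_R(R/p) as the elements  *)
(* killed by p, and E_p for the elements of E killed by p. Both sides of the     *)
(* equivalence amount to: Hom_R(Q, E) is a one-dimensional Q-vector space.      *)
(*   If phi : E_R(R/p) -> E restricts to a generator of Hom_R(Q, E), then every *)
(* f in Hom_R(E_R(R/p), E) is phi composed with some c_n in R_p on the elements *)
(* killed by p^n, because Hom(E_R(R/p), E) = R_p phi + p Hom(E_R(R/p), E); the  *)
(* sequence c_n is Cauchy and unique up to null sequences. Conversely, reducing *)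
(* the isomorphism modulo p gives Hom_R(Q, E) = Q.                              *)
(*   If Hom_R(Q, E) = Q phi, then phi maps Q onto E_p. A Cauchy sequence r_n in *)
(* R/p defines the map lim r_n phi, which equals (a/s) phi; hence s divides a   *)
(* and a/s is the limit of r_n.                                                 *)
(*   If R/p is complete, every endomorphism of E is a scalar on E_p. So every   *)
(* nonzero f : Q -> E maps onto E_p, and its kernel lies in x^-N (R/p) for a    *)
(* parameter x. Therefore any g : Q -> E has a nonzero multiple vanishing on    *)
(* ker f, and this multiple is an endomorphism of E composed with f.            *)

Require Import Defs.
From HB Require Import structures.
From mathcomp Require Import all_boot all_algebra generic_quotient ring_quotient.
From mathcomp Require Import boolp ring.

Set Implicit Arguments.
Unset Strict Implicit.
Unset Printing Implicit Defensive.

Import GRing.Theory.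
Local Open Scope ring_scope.
Local Open Scope quotient_scope.

(** * Ideals of a Noetherian ring *)

(** Both implications pass through a map phi from E_R(R/p) to E whose restriction to Q generates
    Hom_R(Q, E) over Q.

    Given the isomorphism, phi is the preimage of 1 ([iso_dual_dim1]): modulo p every element of the
    completion comes from R_p ([completion_residue]), and multiples by p vanish on Q. Then phi maps
    Q onto E_p, a pointwise limit of multiples of phi is a fraction of phi, and [dual_dim1_complete]
    reads the limit in R/p off that fraction.

    Given completeness, any phi that is nonzero on Q generates ([socle_dual_dim1]). On the elements
    killed by p^n, every map is phi composed with a fraction ([phi_approx]), which is unique modulo
    the n-th power of the maximal ideal of R_p ([phi_act_pow]); [completion_iso] assembles these
    fractions into Cauchy sequences.

    What is needed about E is a finite form of Matlis duality: endomorphisms are scalars on finite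
    sets ([endomorphism_locally_scalar]), and an ideal containing a power of m is the annihilator of
    a finite set ([finite_annihilator]). Completeness glues the scalars on E_p
    ([endomorphism_scalar]). Dimension one enters through [dim1_primary]: an ideal strictly larger
    than p contains a power of m. *)

Section Ideals.
Variable R : comNzRingType.
Implicit Types (J : R -> Prop) (I : {pred R}).

(** Unlike [idealr], this allows the whole ring, which colon ideals and annihilators can be. *)
Record is_ideal J : Prop := IsIdeal {
  is_ideal0 : J 0;
  is_idealD : forall a b, J a -> J b -> J (a + b);
  is_idealM : forall a b, J b -> J (a * b) }.

Lemma is_ideal_sum J n (F : 'I_n -> R) :
  is_ideal J -> (forall i, J (F i)) -> J (\sum_i F i).
Proof.
by move=> hJ hF; elim/big_ind: _ => //; [apply: is_ideal0|apply: is_idealD].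
Qed.

Lemma idealr_is_ideal (I : idealr R) : is_ideal (fun r => r \in (I : pred R)).
Proof.
split=> [|a b Ia Ib|a b Ib]; [exact: idealr0|exact: rpredD|exact: idealMr].
Qed.

Lemma ideal_pow_is_ideal I n : is_ideal (fun r => r \in ideal_pow I n).
Proof.
split=> [|a b|a b]; [exact: ideal_pow_0|exact: ideal_powD|exact: ideal_powMl].
Qed.

Lemma colon_is_ideal J a : is_ideal J -> is_ideal (fun r => J (r * a)).
Proof.
move=> hJ; split=> [|b c|b c]; rewrite ?mul0r ?mulrDl -?mulrA.
- exact: is_ideal0.
- exact: is_idealD.
- exact: is_idealM.
Qed.

Lemma add_ideal_is_ideal J K :
  is_ideal J -> is_ideal K -> is_ideal (fun r => exists2 a, J a & K (r - a)).
Proof.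
move=> hJ hK; split=> [|a b [a' Ja Ka] [b' Jb Kb]|a b [b' Jb Kb]].
- by exists 0; rewrite ?subr0; [exact: is_ideal0 hJ|exact: is_ideal0 hK].
- exists (a' + b'); first exact: is_idealD.
  by rewrite opprD addrACA; apply: is_idealD.
- by exists (a * b'); rewrite -?mulrBr; apply: is_idealM.
Qed.

Lemma principal_is_ideal a : is_ideal (fun r => exists c, r = c * a).
Proof.
split=> [|_ _ [b ->] [c ->]|b _ [c ->]]; first by exists 0; rewrite mul0r.
  by exists (b + c); rewrite mulrDl.
by exists (b * c); rewrite mulrA.
Qed.

Lemma idealr_of_proper J : is_ideal J -> ~ J 1 ->
  exists I : idealr R, forall r, (r \in (I : pred R)) = `[< J r >].
Proof.
move=> hJ J1; pose S : R -> bool := fun r => `[< J r >].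
have SP : idealr_closed S.
  split; first by apply/asboolP; apply: is_ideal0.
    by apply/negP => /asboolP.
  move=> a u v /asboolP Ju /asboolP Jv; apply/asboolP.
  by apply: is_idealD => //; apply: is_idealM.
pose M := isIdealr.Build R S SP.
pose I : idealr R := HB.pack S M.
by exists I.
Qed.

Lemma prime_idealr_of_prime J : is_ideal J -> ~ J 1 ->
  (forall a b, J (a * b) -> J a \/ J b) ->
  exists I : prime_idealr R, forall r, (r \in (I : pred R)) = `[< J r >].
Proof.
move=> hJ J1 Jpr; have [I hI] := idealr_of_proper hJ J1.
have IP : prime_idealr_closed (I : pred R).
  move=> a b; rewrite !hI => /asboolP/Jpr [?|?]; apply/orP.
    by left; apply/asboolP.
  by right; apply/asboolP.
pose M := isPrimeIdealrClosed.Build R (I : pred R) IP.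
pose I' : prime_idealr R := HB.pack (I : pred R) I M.
by exists I'.
Qed.

Lemma ideal_pow0 I r : r \in ideal_pow I 0.
Proof.
apply/asboolP; exists 1%N, (fun=> r), (fun _ _ => 0); split=> [? []//|].
by rewrite big_ord1 big_ord0 mulr1.
Qed.

Lemma ideal_pow_mem I n a b :
  a \in I -> b \in ideal_pow I n -> a * b \in ideal_pow I n.+1.
Proof.
move=> Ia /asboolP [k [c [u [uI ->]]]]; apply/asboolP.
exists k, c, (fun i j => if unlift ord0 j is Some j' then u i j' else a).
split=> [i j|]; first by case: unlift.
rewrite mulr_sumr; apply: eq_bigr => i _; rewrite big_ord_recl unlift_none.
rewrite mulrCA; congr (_ * (_ * _)).
by apply: eq_bigr => j _; rewrite liftK.
Qed.

Lemma ideal_powSP I n J : is_ideal J ->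
  (forall a b, a \in I -> b \in ideal_pow I n -> J (a * b)) ->
  forall r, r \in ideal_pow I n.+1 -> J r.
Proof.
move=> hJ IJ r /asboolP [k [c [u [uI ->]]]]; apply: is_ideal_sum => // i.
rewrite big_ord_recl; apply: is_idealM => //; apply: IJ => //.
apply/asboolP; exists 1%N, (fun=> 1), (fun _ j => u i (lift ord0 j)).
by split=> //; rewrite big_ord1 mul1r.
Qed.

Lemma ideal_pow_rec I (S : nat -> R -> Prop) : (forall n, is_ideal (S n)) ->
  S 0%N 1 -> (forall n a b, a \in I -> S n b -> S n.+1 (a * b)) ->
  forall n r, r \in ideal_pow I n -> S n r.
Proof.
move=> hS S0 SS; elim=> [|n IHn] r.
  by move=> _; rewrite -[r]mulr1; apply: is_idealM.
by apply: ideal_powSP => // a b Ia /IHn; apply: SS.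
Qed.

Lemma ideal_powS I n r : r \in ideal_pow I n.+1 -> r \in ideal_pow I n.
Proof.
apply: (ideal_powSP (ideal_pow_is_ideal I n)) => a b _.
exact: ideal_powMl.
Qed.

Lemma ideal_pow_le I n k r : (n <= k)%N ->
  r \in ideal_pow I k -> r \in ideal_pow I n.
Proof.
by move=> /subnK <-; elim: (k - n)%N => // d IHd /ideal_powS /IHd.
Qed.

Lemma ideal_pow_exp I a n : a \in I -> a ^+ n \in ideal_pow I n.
Proof.
move=> Ia; elim: n => [|n IHn]; first exact: ideal_pow0.
by rewrite exprS; apply: ideal_pow_mem.
Qed.

Hypothesis R_noeth : noetherian R.

Lemma noetherian_fg J : is_ideal J -> exists (n : nat) (g : 'I_n -> R),
  (forall i, J (g i)) /\ forall r, J r <-> exists c : 'I_n -> R, r = \sum_i c i * g i.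
Proof.
move=> hJ.
have [n [g hg]] : exists (n : nat) (g : 'I_n -> R),
    forall r, J r <-> exists c : 'I_n -> R, r = \sum_i c i * g i.
  have [J1|J1] := pselect (J 1).
    exists 1%N, (fun=> 1) => r; split=> [_|_]; last first.
      by rewrite -[r]mulr1; apply: is_idealM.
    by exists (fun=> r); rewrite big_ord1 mulr1.
  have [I hI] := idealr_of_proper hJ J1; have [n [g hg]] := R_noeth I.
  by exists n, g => r; rewrite -hg hI; split=> /asboolP.
exists n, g; split=> // i; apply/hg; exists (fun j => (j == i)%:R).
by rewrite (bigD1 i) //= eqxx mul1r big1 ?addr0 // => j /negPf ->; rewrite mul0r.
Qed.

(** Without a maximal member, choice builds a strictly increasing chain; but the generators of its
    union already lie in one term. *)
Lemma noetherian_max (P : (R -> Prop) -> Prop) J0 : is_ideal J0 -> P J0 ->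
  exists J, [/\ is_ideal J, P J & forall J', is_ideal J' -> P J' ->
    (forall r, J r -> J' r) -> forall r, J' r -> J r].
Proof.
move=> hJ0 PJ0; apply: contrapT => nmax.
pose T := {J | is_ideal J /\ P J}.
have next (J : T) : exists J' : T,
    (forall r, sval J r -> sval J' r) /\ ~ (forall r, sval J' r -> sval J r).
  case: J => J [hJ PJ] /=; apply: contrapT => nJ.
  apply: nmax; exists J; split=> // J' hJ' PJ' JJ'; apply: contrapT => J'J.
  by apply: nJ; exists (exist _ J' (conj hJ' PJ')).
have [f hf] := choice next.
pose K n : T := iter n f (exist _ J0 (conj hJ0 PJ0)).
have KS n r : sval (K n) r -> sval (K n.+1) r by apply: (hf (K n)).1.
have Kle n k r : (n <= k)%N -> sval (K n) r -> sval (K k) r.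
  by move=> /subnK <-; elim: (k - n)%N => // d IHd /IHd /KS.
have hU : is_ideal (fun r => exists n, sval (K n) r).
  split=> [|a b [n Ka] [k Kb]|a b [n Kb]].
  - by exists 0%N; apply: is_ideal0; case: (svalP (K 0%N)).
  - exists (maxn n k); case: (svalP (K (maxn n k))) => hK _.
    by apply: (is_idealD hK); [apply: Kle Ka; apply: leq_maxl|apply: Kle Kb; apply: leq_maxr].
  - by exists n; case: (svalP (K n)) => hK _; apply: (is_idealM hK).
have [n [g [gU hg]]] := noetherian_fg hU.
have [k hk] := choice gU.
pose N := \max_i k i.
apply: (hf (K N)).2 => r Kr.
have /hg [c ->] : exists n, sval (K n) r by exists N.+1.
case: (svalP (K N)) => hK _; apply: is_ideal_sum => // i.
by apply: is_idealM => //; apply: Kle (hk i); apply: leq_bigmax.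
Qed.

(** Take the largest exponent over finitely many generators of I, plus one for the factor that is
    expanded in the generators. *)
Lemma common_pow I (J : R -> Prop) (hI : is_ideal (fun r => r \in I)) :
  is_ideal J ->
  (forall a, a \in I -> exists n, forall b, b \in ideal_pow I n -> J (b * a)) ->
  exists n, forall b, b \in ideal_pow I n -> J b.
Proof.
move=> hJ IJ; have [n [g [gI hg]]] := noetherian_fg hI.
have [k hk] := choice (fun i => IJ _ (gI i)).
exists (\max_i k i).+1; apply: ideal_powSP => // _ b /hg [c ->] Ib.
rewrite mulr_suml; apply: is_ideal_sum => // i; rewrite -mulrA.
apply: is_idealM => //; rewrite mulrC; apply: hk.
by apply: ideal_pow_le Ib; apply: leq_bigmax.
Qed.

(* The witness b maximizes the colon ideal (J : b) among the b that no power of *)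
(* I multiplies into J.                                                         *)
Lemma associated_prime I (J : R -> Prop) : is_ideal (fun r => r \in I) ->
  is_ideal J -> (forall n, ~ forall b, b \in ideal_pow I n -> J b) ->
  exists b, [/\ ~ J b, forall r s, J (r * s * b) -> J (r * b) \/ J (s * b) &
    exists2 x, x \in I & ~ J (x * b)].
Proof.
move=> hI hJ nJ.
pose bad b := forall n, ~ forall c, c \in ideal_pow I n -> J (c * b).
have bad1 : bad 1 by move=> n h; apply: (nJ n) => c /h; rewrite mulr1.
have badI b : bad b -> exists2 x, x \in I & bad (x * b).
  move=> bad_b; apply: contrapT => nx.
  have [|n hn] := common_pow hI (colon_is_ideal b hJ); last exact: (bad_b n).
  move=> a Ia; apply: contrapT => na; apply: nx; exists a => // n hn.
  by apply: na; exists n => c Ic; rewrite -mulrA; apply: hn.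
have badJ b : bad b -> ~ J b.
  by move=> bad_b Jb; apply: (bad_b 0%N) => c _; apply: is_idealM.
pose P K := exists2 b, bad b & forall r, K r <-> J (r * b).
have [|K [hK [b bad_b Kb] Kmax]] := @noetherian_max P _ (colon_is_ideal 1 hJ).
  by exists 1.
have maxb c : bad (c * b) -> forall r, J (r * (c * b)) -> J (r * b).
  move=> bad_cb r Jr; apply/Kb.
  apply: (Kmax _ (colon_is_ideal (c * b) hJ)) => //; first by exists (c * b).
  by move=> s /Kb Js; rewrite mulrCA; apply: is_idealM.
exists b; split.
- exact: badJ.
- move=> r s Jrsb; have [bad_sb|] := pselect (bad (s * b)).
    by left; apply: maxb bad_sb _ _; rewrite mulrA.
  move=> /existsNP [n /contrapT hn]; right.
  (* Some x in I^n keeps x b bad, while x s b lies in J; maximality at x b then puts s b into J. *)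
  have [x Ix bad_xb] : exists2 x, x \in ideal_pow I n & bad (x * b).
    elim: n {hn} => [|n [x Ix bad_xb]]; first by exists 1; rewrite ?ideal_pow0 ?mul1r.
    have [y Iy bad_yxb] := badI _ bad_xb.
    by exists (y * x); rewrite ?ideal_pow_mem // -mulrA.
  by apply: maxb bad_xb _ _; rewrite mulrCA; apply: hn.
- have [x Ix bad_xb] := badI _ bad_b.
  by exists x => //; apply: badJ.
Qed.

End Ideals.

(** * Local rings and injective modules *)

Section LocalRing.
Variables (R : comNzRingType) (m : idealr R).
Hypotheses (R_noeth : noetherian R) (R_local : local_ring m).

(** The Noetherian property replaces Zorn's lemma in finding a maximal ideal that contains a
    non-unit. *)
Lemma local_inv r : r \notin (m : pred R) -> exists c, c * r = 1.
Proof.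
move=> rm; apply: contrapT => nr.
pose P J := ~ J 1 /\ J r.
have [|J [hJ [J1 Jr] Jmax]] := noetherian_max R_noeth (P := P) (principal_is_ideal r).
  by split=> [[c rc]|]; [apply: nr; exists c|exists 1; rewrite mul1r].
have [M hM] := idealr_of_proper hJ J1.
have M_max : maximal_ideal M.
  move=> K MK a; apply/idP/idP; last exact: MK.
  rewrite hM => Ka; apply/asboolP; apply: Jmax (idealr_is_ideal K) _ _ _ Ka.
    by split; [rewrite idealr1|apply: MK; rewrite hM; apply/asboolP].
  by move=> b Jb; apply: MK; rewrite hM; apply/asboolP.
by move: rm; rewrite -(R_local.2 _ M_max) hM; case: asboolP.
Qed.

Lemma local_prime a b : a * b \in (m : pred R) ->
  a \in (m : pred R) \/ b \in (m : pred R).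
Proof.
move=> mab; case: (boolP (a \in (m : pred R))) => [|/local_inv [c ca]]; [by left|].
by right; rewrite -[b]mul1r -ca -mulrA idealMr.
Qed.

Lemma proper_sub_local (J : R -> Prop) : is_ideal J -> ~ J 1 ->
  forall r, J r -> r \in (m : pred R).
Proof.
move=> hJ J1 r Jr; case: (boolP (r \in (m : pred R))) => // /local_inv [c cr].
by case: J1; rewrite -cr; apply: is_idealM.
Qed.

End LocalRing.

Section Submodule.
Variables (R : comNzRingType) (M : lmodType R) (N : M -> Prop).
Hypothesis (N0 : N 0) (NP : forall a x y, N x -> N y -> N (a *: x + y)).

Definition submod_pred : pred M := fun x => `[< N x >].

Lemma submod_pred_closed : submod_closed submod_pred.
Proof.
by split=> [|a x y /asboolP Nx /asboolP Ny]; apply/asboolP; [|apply: NP].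
Qed.

HB.instance Definition _ :=
  GRing.isSubmodClosed.Build R M submod_pred submod_pred_closed.

Record submodule := Submodule { submod_val :> M; _ : submod_val \in submod_pred }.

HB.instance Definition _ := [isSub for submod_val].
HB.instance Definition _ := [Choice of submodule by <:].
HB.instance Definition _ := [SubChoice_isSubLmodule of submodule by <:].

(** Turns a predicate into an injective map, the form in which [injective_module] can be applied. *)
Lemma submod_ex : exists (S : lmodType R) (i : {linear S -> M}),
  injective i /\ forall x, N x <-> exists s, i s = x.
Proof.
exists submodule, (val : {linear submodule -> M}); split; first exact: val_inj.
move=> x; split=> [Nx|[s <-]]; last by case: s => y /= /asboolP.
have xN : x \in submod_pred by apply/asboolP.
by exists (Submodule xN).
Qed.

End Submodule.

Section Extension.
Variables (R : comNzRingType) (E : lmodType R).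
Hypothesis E_inj : injective_module E.

Lemma linear_of (A B : lmodType R) (f : A -> B) :
  (forall a x y, f (a *: x + y) = a *: f x + f y) ->
  exists h : {linear A -> B}, forall x, h x = f x.
Proof.
move=> fP; pose L := GRing.isLinear.Build R A B *:%R f fP.
by pose h : {linear A -> B} := HB.pack f L; exists h.
Qed.

(** As ker f is contained in ker g, g factors through the image of f; injectivity extends the factor
    to M. *)
Lemma extend_factor (W M : lmodType R) (f : {linear W -> M}) (g : {linear W -> E}) :
  (forall w, f w = 0 -> g w = 0) -> exists h : {linear M -> E}, forall w, h (f w) = g w.
Proof.
move=> fg.
have [||S [i [i_inj iP]]] := @submod_ex R M (fun x => exists w, f w = x).
- by exists 0; rewrite linear0.
- by move=> a _ _ [x <-] [y <-]; exists (a *: x + y); rewrite linearP.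
have fS s : exists w, f w = i s by apply/iP; exists s.
have [k hk] := choice fS.
have gP w w' : f w = f w' -> g w = g w'.
  by move=> E'; apply/eqP; rewrite -subr_eq0 -linearB; apply/eqP/fg; rewrite linearB E' subrr.
have [|g' hg'] := @linear_of S E (fun s => g (k s)).
  by move=> a x y; rewrite -linearP; apply: gP; rewrite linearP !hk linearP.
have [h hh] := E_inj g' i_inj; exists h => w.
have /iP [s hs] : exists w', f w' = f w by exists w.
by rewrite -hs hh hg'; apply: gP; rewrite hk.
Qed.

Lemma extend_factor_on (W M : lmodType R) (N : W -> Prop)
    (f : {linear W -> M}) (g : {linear W -> E}) :
  N 0 -> (forall a x y, N x -> N y -> N (a *: x + y)) ->
  (forall w, N w -> f w = 0 -> g w = 0) ->
  exists h : {linear M -> E}, forall w, N w -> h (f w) = g w.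
Proof.
move=> N0 NP fg; have [S [i [_ iP]]] := submod_ex N0 NP.
have [|h hh] := @extend_factor S M (f \o i) (g \o i).
  by move=> s; apply: fg; apply/iP; exists s.
by exists h => w /iP [s <-]; apply: hh.
Qed.

(** The f i form a single map into M^n; the h i are the components of an extension along it. *)
Lemma extend_factor_family (W M : lmodType R) n
    (f : 'I_n -> {linear W -> M}) (g : {linear W -> E}) :
  (forall w, (forall i, f i w = 0) -> g w = 0) ->
  exists h : 'I_n -> {linear M -> E}, forall w, g w = \sum_i h i (f i w).
Proof.
move=> fg.
have [|F hF] := @linear_of W {ffun 'I_n -> M} (fun w => [ffun i => f i w]).
  by move=> a x y; apply/ffunP => i; rewrite !ffunE linearP.
have [|h hh] := @extend_factor _ _ F g.
  by move=> w; rewrite hF => /ffunP Fw; apply: fg => i; have := Fw i; rewrite !ffunE.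
have D i : exists d : {linear M -> {ffun 'I_n -> M}},
    forall x, d x = [ffun j => if j == i then x else 0].
  apply: linear_of => a x y; apply/ffunP => j; rewrite !ffunE.
  by case: eqP => // _; rewrite scaler0 addr0.
have [d hd] := choice D.
exists (fun i => h \o d i) => w; rewrite -hh -linear_sum; congr (h _).
rewrite hF; apply/ffunP => j; rewrite sum_ffunE ffunE (bigD1 j) //=.
rewrite hd ffunE eqxx big1 ?addr0 // => i /negPf ij.
by rewrite hd ffunE eq_sym ij.
Qed.

Lemma scale_linear (M : lmodType R) (v : M) :
  exists h : {linear R^o -> M}, forall r, h r = (r : R) *: v.
Proof. by apply: linear_of => a x y; rewrite scalerDl scalerA. Qed.

Lemma mul_linear (M : lmodType R) (a : R) :
  exists h : {linear M -> M}, forall x, h x = a *: x.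
Proof. by apply: linear_of => c x y; rewrite scalerDr !scalerA mulrC. Qed.

Lemma extend_at (M : lmodType R) (v : M) (e : E) :
  (forall r : R, r *: v = 0 -> r *: e = 0) -> exists h : {linear M -> E}, h v = e.
Proof.
move=> ve; have [f hf] := scale_linear v; have [g hg] := scale_linear e.
have [|h hh] := @extend_factor _ _ f g; first by move=> r; rewrite hf hg; apply: ve.
by exists h; rewrite -[v]scale1r -hf hh hg scale1r.
Qed.

(** The hypothesis makes r a + j -> r u well defined on R a + J; e is the value at 1 of an extension
    to R. *)
Lemma injective_cogenerator (J : R -> Prop) (u : E) (a : R) : is_ideal J ->
  (forall r, J (r * a) -> r *: u = 0) ->
  exists e, (forall j, J j -> j *: e = 0) /\ a *: e = u.
Proof.
move=> hJ Ju.
have [|f hf] := @linear_of (R^o * R^o)%type R^o (fun w => w.1 * a + w.2).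
  by move=> c [x y] [x' y'] /=; rewrite mulrDl scalerDr scalerAl addrACA.
have [|g hg] := @linear_of (R^o * R^o)%type E (fun w => (w.1 : R) *: u).
  by move=> c [x y] [x' y'] /=; rewrite scalerDl scalerA.
have [||w Jw|h hh] := @extend_factor_on (R^o * R^o)%type R^o (fun w : R^o * R^o => J w.2) f g.
- exact: is_ideal0 hJ.
- by move=> c x y Jx Jy; apply: (is_idealD hJ) => //; apply: is_idealM.
- rewrite hf hg => /eqP; rewrite addr_eq0 => /eqP Ew; apply: Ju; rewrite Ew.
  by rewrite -mulN1r; apply: (is_idealM hJ (-1) Jw).
have hE (r : R^o) : h r = (r : R) *: h 1 by rewrite -linearZ /= /GRing.scale /= mulr1.
exists (h 1); split=> [j Jj|]; rewrite -hE.
  by have := hh (0, j) Jj; rewrite hf hg /= mul0r add0r scale0r.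
by have := hh (1, 0) (is_ideal0 hJ); rewrite hf hg /= mul1r addr0 scale1r.
Qed.

End Extension.

(** * Injective hulls *)

(** Hulls are used only through this elementwise form: u is the image of 1, and essentiality is
    tested on the submodules R y. *)
Lemma injective_hull_cyclic (R : comNzRingType) (I : idealr R) (H : lmodType R) :
  injective_hull (restr (\pi_{ideal_quot I} : {rmorphism R -> _})) H ->
  injective_module H /\ exists u : H,
    (forall r, r *: u = 0 <-> r \in (I : pred R)) /\
    (forall y : H, y != 0 -> exists r t, r *: y = t *: u /\ t \notin (I : pred R)).
Proof.
move=> [H_inj [i [i_inj i_ess]]]; split=> //.
pose pi : {rmorphism R -> {ideal_quot I}} := \pi_{ideal_quot I}.
have iE r : i (pi r) = r *: i (pi 1).
  rewrite -linearZ; congr (i _).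
  by rewrite /GRing.scale /= /restr_scale rmorph1 [RHS]mulr1.
have u0 r : r *: i (pi 1) = 0 <-> r \in (I : pred R).
  rewrite -iE -{2}[r]subr0 Quotient.idealrBE -[\pi r]/(pi r) -[\pi 0]/(pi 0).
  rewrite rmorph0; split=> [i0|/eqP ->]; last exact: linear0.
  by apply/eqP/i_inj; rewrite i0 linear0.
exists (i (pi 1)); split=> // y y0.
pose N : {pred H} := fun x => `[< exists r, x = r *: y >].
have hN : submod_closed N.
  split=> [|a _ _ /asboolP [b ->] /asboolP [c ->]]; apply/asboolP.
    by exists 0; rewrite scale0r.
  by exists (a * b + c); rewrite scalerDl scalerA.
have [|x [/asboolP [r Er] x0]] := i_ess N hN.
  by exists y => //; apply/asboolP; exists 1; rewrite scale1r.
have Ex : x = pi (repr (x : {ideal_quot I})) by rewrite /pi /= reprK.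
move: Er x0; rewrite Ex iE => Er x0; exists r, (repr (x : {ideal_quot I})).
by split=> //; apply/negP => /u0 tu; rewrite tu eqxx in x0.
Qed.

Lemma ann_is_ideal (R : comNzRingType) (M : lmodType R) (y : M) :
  is_ideal (fun r => r *: y = 0).
Proof.
split=> [|a b ay by0|a b by0]; first by rewrite scale0r.
  by rewrite scalerDl ay by0 addr0.
by rewrite -scalerA by0 scaler0.
Qed.

Section HullOfPrime.
Variables (R : comNzRingType) (R_noeth : noetherian R) (P : idealr R).
Hypothesis P_prime : forall a b, a * b \in (P : pred R) ->
  a \in (P : pred R) \/ b \in (P : pred R).
Variables (H : lmodType R) (u : H).
Hypothesis H_inj : injective_module H.
Hypothesis u0 : forall r, r *: u = 0 <-> r \in (P : pred R).
Hypothesis u_ess : forall y : H, y != 0 ->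
  exists r t, r *: y = t *: u /\ t \notin (P : pred R).

(** Otherwise some b y has a prime annihilator missing an x in P. A nonzero multiple r b y lies in R
    u and is killed by x, so primality forces r b y = 0. *)
Lemma hull_torsion (y : H) : exists n, forall b, b \in ideal_pow (P : pred R) n -> b *: y = 0.
Proof.
apply: contrapT => ny.
have [|b [by0 b_prime [x Px xb]]] :=
  associated_prime R_noeth (idealr_is_ideal P) (ann_is_ideal y).
  by move=> n hn; apply: ny; exists n.
have [|r [t [rt /negP tP]]] := u_ess (y := b *: y); first exact/eqP.
have /b_prime [//|rb0] : (x * r * b) *: y = 0.
  by rewrite -!scalerA rt scalerA mulrC -scalerA (u0 x).2 ?scaler0.
by apply/tP/u0; rewrite -rt scalerA.
Qed.

Lemma hull_scaler_inj s (y : H) : s \notin (P : pred R) -> s *: y = 0 -> y = 0.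
Proof.
move=> sP sy; apply/eqP; apply: contrapT => /negP /u_ess [r [t [rt tP]]].
have : s *: (t *: u) = 0 by rewrite -rt !scalerA mulrC -scalerA sy scaler0.
by rewrite scalerA u0 => /P_prime []; apply/negP.
Qed.

(** Multiplication by s is injective, so the identity extends along it. *)
Lemma hull_scaler_surj s (y : H) : s \notin (P : pred R) -> exists y', s *: y' = y.
Proof.
move=> sP; have [f hf] := mul_linear H s.
have [|h hh] := extend_factor H_inj (f := f) (g := idfun).
  by move=> w; rewrite hf; apply: hull_scaler_inj.
by exists (h y); rewrite -linearZ /= -hf hh.
Qed.

(** The part of the hull killed by P is the fraction field of R/P, with u in the place of 1. *)
Lemma hull_socle (y : H) : (forall a, a \in (P : pred R) -> a *: y = 0) ->
  exists s r, s \notin (P : pred R) /\ s *: y = r *: u.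
Proof.
move=> Py; have [->|/u_ess [s [r [sr rP]]]] := eqVneq y 0.
  by exists 1, 0; rewrite idealr1 scaler0 scale0r.
exists s, r; split=> //; apply/negP => /Py sy.
by case/negP: rP; apply/u0; rewrite -sr.
Qed.

End HullOfPrime.

(** * The injective hull of the residue field *)

Section HullOfResidueField.
Variables (R : comNzRingType) (m : idealr R).
Hypotheses (R_noeth : noetherian R) (R_local : local_ring m).
Variables (E : lmodType R) (z : E).
Hypothesis E_inj : injective_module E.
Hypothesis z0 : forall r, r *: z = 0 <-> r \in (m : pred R).
Hypothesis z_ess : forall y : E, y != 0 ->
  exists r t, r *: y = t *: z /\ t \notin (m : pred R).
Local Notation m' := (m : pred R).

Lemma residue_torsion (y : E) :
  exists n, forall b, b \in ideal_pow m' n -> b *: y = 0.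
Proof. exact: (hull_torsion R_noeth z0 z_ess). Qed.

Lemma residue_socle (y : E) : (forall a, a \in m' -> a *: y = 0) ->
  exists c, y = c *: z.
Proof.
move=> /(hull_socle z0 z_ess) [s [r [/(local_inv R_noeth R_local) [c cs] sr]]].
by exists (c * r); rewrite -scalerA -sr scalerA cs scale1r.
Qed.

(** If r a lies in J then r is not a unit, as a is outside J; hence r z = 0, as
    [injective_cogenerator] asks. *)
Lemma residue_cogenerator (J : R -> Prop) a : is_ideal J -> ~ J a ->
  exists e : E, (forall j, J j -> j *: e = 0) /\ a *: e = z.
Proof.
move=> hJ Ja; apply: (injective_cogenerator E_inj hJ) => r Jra; apply/z0.
case: (boolP (r \in m')) => // /(local_inv R_noeth R_local) [c cr].
by case: Ja; rewrite -[a]mul1r -cr -mulrA; apply: is_idealM.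
Qed.

Lemma residue_generator_neq0 : z <> 0.
Proof. by rewrite -[z]scale1r => /z0; rewrite idealr1. Qed.

(** Stands in for the theorem that End(E) is the completion of R: on a finite set, a scalar from R
    itself suffices. *)
Definition locally_scalar (s : seq E) : Prop :=
  forall h : {linear E -> E}, exists d : R, forall e, e \in s -> h e = d *: e.

Lemma locally_scalar_sub s s' :
  {subset s <= s'} -> locally_scalar s' -> locally_scalar s.
Proof. by move=> ss' hs' h; have [d hd] := hs' h; exists d => e /ss'; apply: hd. Qed.

(* Matlis duality for the module generated by s: if Ann(s) kills e, then e is a *)
(* sum of images of elements of s under endomorphisms of E.                     *)
Lemma locally_scalar_ann s e : locally_scalar s ->
  (forall r, (forall x, x \in s -> r *: x = 0) -> r *: e = 0) ->
  locally_scalar (e :: s).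
Proof.
move=> hs se.
have F (x : E) := scale_linear x.
have [f hf] := choice (fun i : 'I_(size s) => F s`_i); have [g hg] := F e.
have [|h hh] := extend_factor_family E_inj (f := f) (g := g).
  move=> r fr; rewrite hg; apply: se => x /(nthP 0) [i si <-].
  by have := fr (Ordinal si); rewrite hf.
have [c hc] := choice (fun i => hs (h i)).
move=> h'; have [d hd] := hs h'; exists d => x; rewrite inE => /predU1P [->|]; last exact: hd.
have -> : e = \sum_i c i *: s`_i.
  rewrite -[e]scale1r -hg hh; apply: eq_bigr => i _.
  by rewrite hf scale1r hc ?mem_nth.
rewrite linear_sum scaler_sumr; apply: eq_bigr => i _.
by rewrite linearZ /= hd ?mem_nth // !scalerA mulrC.
Qed.

(* If Ann(s) does not kill e, it maps e onto the socle of E; a scalar agreeing with h *)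
(* on s is then corrected on e by an element of Ann(s).                              *)
Lemma locally_scalar_cons s e : locally_scalar s ->
  (forall h : {linear E -> E}, (forall x, x \in s -> h x = 0) ->
     forall a, a \in m' -> a *: h e = 0) ->
  locally_scalar (e :: s).
Proof.
move=> hs se.
have [ann|] := pselect (forall r, (forall x, x \in s -> r *: x = 0) -> r *: e = 0).
  exact: locally_scalar_ann.
move=> /existsNP [r /not_implyP [rs re]].
have [c Ec] : exists c, r *: e = c *: z.
  apply: residue_socle => a ma; have [f hf] := mul_linear E r.
  by rewrite -hf; apply: se => // x /rs; rewrite hf.
have /(local_inv R_noeth R_local) [c' cc] : c \notin m'.
  by apply/negP => /z0 cz; apply: re; rewrite Ec.
have Ez : z = (c' * r) *: e by rewrite -scalerA Ec scalerA cc scale1r.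
move=> h; have [d hd] := hs h; have [f hf] := mul_linear E d.
have [b Eb] : exists b, h e - d *: e = b *: z.
  apply: residue_socle => a ma; have := se (h \- f) _ a ma.
  by rewrite /= hf => -> // x xs; rewrite hf hd // subrr.
exists (d + b * c' * r) => x; rewrite inE => /predU1P [->|xs].
  by rewrite scalerDl -mulrA -scalerA -Ez -Eb addrC subrK.
by rewrite scalerDl -scalerA rs // scaler0 addr0 hd.
Qed.

(** Induction on the power of m that kills e: first adjoin the multiples of e by generators of m,
    which a smaller power kills. An endomorphism vanishing on these maps e into the socle, so
    [locally_scalar_cons] applies. *)
Lemma endomorphism_locally_scalar s : locally_scalar s.
Proof.
have step n : forall e s, (forall b, b \in ideal_pow m' n -> b *: e = 0) ->
    locally_scalar s -> locally_scalar (e :: s).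
  elim: n => [|n IHn] {s} e s ne hs.
    have -> : e = 0 by rewrite -[e]scale1r ne ?ideal_pow0.
    move=> h; have [d hd] := hs h; exists d => x; rewrite inE => /predU1P [->|/hd//].
    by rewrite linear0 scaler0.
  have [k [g [gm hg]]] := noetherian_fg R_noeth (idealr_is_ideal m).
  have : locally_scalar ([seq g i *: e | i <- enum 'I_k] ++ s).
    elim: (enum 'I_k) => //= i l IHl; apply: IHn => // b mb.
    by rewrite scalerA mulrC; apply: ne; apply: ideal_pow_mem.
  move=> hgs; apply: (@locally_scalar_sub _ (e :: [seq g i *: e | i <- enum 'I_k] ++ s)).
    by move=> x; rewrite !inE mem_cat => /orP [->|->]; rewrite ?orbT.
  apply: locally_scalar_cons => // h hs0 a /hg [c ->].
  rewrite scaler_suml big1 // => i _; rewrite -scalerA -[g i *: h e]linearZ_LR hs0 ?scaler0 //.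
  by rewrite mem_cat; apply/orP; left; apply/mapP; exists i; rewrite ?mem_enum.
elim: s => [|e s IHs]; first by move=> h; exists 0.
by have [n hn] := residue_torsion e; apply: step hn IHs.
Qed.

(** Noetherian induction. For a maximal counterexample K, take v outside K with m v in K. Then K + R
    v is the annihilator of a finite set, and one more element e, with K e = 0 and v e = z, cuts it
    down to K. *)
Lemma finite_annihilator (J : R -> Prop) n : is_ideal J ->
  (forall b, b \in ideal_pow m' n -> J b) ->
  exists s : seq E, forall r, J r <-> forall e, e \in s -> r *: e = 0.
Proof.
move=> hJ nJ; apply: contrapT => Jbad.
pose P K := (forall b, b \in ideal_pow m' n -> K b) /\
  ~ exists s : seq E, forall r, K r <-> forall e, e \in s -> r *: e = 0.
have [|K [hK [nK Kbad] Kmax]] := noetherian_max R_noeth (P := P) hJ; first by [].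
have K1 : ~ K 1.
  move=> K1; apply: Kbad; exists [::] => r; split=> // _.
  by rewrite -[r]mulr1; apply: is_idealM.
have [v [Kv mv]] : exists v, ~ K v /\ forall a, a \in m' -> K (a * v).
  have : forall b, b \in ideal_pow m' n -> K (b * 1) by move=> b; rewrite mulr1; apply: nK.
  elim: n {nJ P nK Kmax} (1) K1 => [|k IHk] r Kr kr.
    by case: Kr; rewrite -[r]mul1r; apply: kr; apply: ideal_pow0.
  have [mr|/existsNP [a /not_implyP [ma Kar]]] := pselect (forall a, a \in m' -> K (a * r)).
    by exists r.
  apply: IHk Kar _ => b mb; rewrite mulrA [b * a]mulrC; apply: kr.
  exact: ideal_pow_mem.
pose L r := exists2 a, (exists c, a = c * v) & K (r - a).
have hL : is_ideal L := add_ideal_is_ideal (principal_is_ideal v) hK.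
have KL r : K r -> L r by exists 0; rewrite ?subr0 //; exists 0; rewrite mul0r.
have [s hs] : exists s : seq E, forall r, L r <-> forall e, e \in s -> r *: e = 0.
  apply: contrapT => Lbad; apply: Kv; apply: (Kmax L) => //.
    by split=> // b /nK /KL.
  by exists v; [exists 1; rewrite mul1r|rewrite subrr; apply: is_ideal0 hK].
have [e [Ke ve]] := residue_cogenerator hK Kv.
apply: Kbad; exists (e :: s) => r; split=> [Kr x|rs].
  by rewrite inE => /predU1P [->|]; [exact: Ke|move: x; exact/hs/KL].
have /hs [_ [c ->] Krc] : forall e, e \in s -> r *: e = 0.
  by move=> x xs; apply: rs; rewrite inE xs orbT.
have : c *: z = 0.
  have /Ke : K (r - c * v) by [].
  rewrite scalerBl rs ?mem_head // sub0r -scalerA ve => /eqP.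
  by rewrite oppr_eq0 => /eqP.
by move=> /z0 /mv Kcv; rewrite -[r](subrK (c * v)); apply: is_idealD.
Qed.

End HullOfResidueField.

(** * The action of the localization *)

Section FractionAction.
Variables (R : comNzRingType) (p : prime_idealr R).
Local Notation P := (p : pred R).
Local Notation Rp := (localization p).
Local Notation frac := (\pi_(localization p)).
Implicit Types (a : R) (s t : denom p) (c : Rp).

Lemma prime_idealrP a b : a * b \in P -> a \in P \/ b \in P.
Proof. by rewrite prime_idealrM => /orP. Qed.

Lemma frac_eq a s b t : a * val t = b * val s -> frac (a, s) = frac (b, t).
Proof. by move=> E; apply: loc_eq1. Qed.

Lemma fracD a s b t :
  frac (a, s) + frac (b, t) = frac (a * val t + b * val s, denomM s t).
Proof. exact: loc_pi_add. Qed.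

Lemma fracM a s b t : frac (a, s) * frac (b, t) = frac (a * b, denomM s t).
Proof. exact: loc_pi_mul. Qed.

Lemma fracP c : exists a s, c = frac (a, s).
Proof. by elim/quotW: c => -[a s]; exists a, s. Qed.

Lemma to_loc_max a : a \in P -> to_loc p a \in loc_max p.
Proof.
move=> Pa; apply/asboolP; exists 1%N, (fun=> 1), (fun=> a).
by split=> //; rewrite big_ord1 mul1r.
Qed.

Lemma frac_pow n a s : a \in ideal_pow P n -> frac (a, s) \in ideal_pow (loc_max p) n.
Proof.
have -> : frac (a, s) = frac (1, s) * to_loc p a.
  by rewrite fracM; apply: frac_eq => /=; ring.
move=> Pa; apply: ideal_powMl.
move: n a Pa; apply: ideal_pow_rec => [n||n a b Pa].
- split=> [|a b|a b]; rewrite ?rmorph0 ?rmorphD ?rmorphM; first exact: ideal_pow_0.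
    exact: ideal_powD.
  exact: ideal_powMl.
- exact: ideal_pow0.
- by rewrite rmorphM; apply: ideal_pow_mem; apply: to_loc_max.
Qed.

Lemma frac_powP n c : c \in ideal_pow (loc_max p) n ->
  exists a s, c = frac (a, s) /\ a \in ideal_pow P n.
Proof.
move: n c; apply: ideal_pow_rec => [n||n c d /loc_maxP [[a s] [-> /= Pa]]].
- split=> [|c d [a [s [-> Pa]]] [b [t [-> Pb]]]|c d [b [t [-> Pb]]]].
  + by exists 0, (denom1 p); split=> //; apply: ideal_pow_0.
  + exists (a * val t + b * val s), (denomM s t); rewrite fracD; split=> //.
    by apply: ideal_powD; apply: ideal_powMr.
  + have [a [s ->]] := fracP c; exists (a * b), (denomM s t).
    by rewrite fracM; split=> //; apply: ideal_powMl.
- by exists 1, (denom1 p); split=> //; apply: ideal_pow0.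
- move=> [b [t [-> Pb]]]; exists (a * b), (denomM s t).
  by rewrite fracM; split=> //; apply: ideal_pow_mem.
Qed.

(** This is the n-th symbolic power of p. *)
Lemma saturated_pow n :
  is_ideal (fun r => exists t, val t * r \in ideal_pow P n).
Proof.
split=> [|a b [s Pa] [t Pb]|a b [t Pb]].
- by exists (denom1 p); rewrite mulr0 ideal_pow_0.
- exists (denomM s t); rewrite /=.
  have -> : val s * val t * (a + b) = val t * (val s * a) + val s * (val t * b) by ring.
  by apply: ideal_powD; apply: ideal_powMl.
- by exists t; rewrite mulrCA ideal_powMl.
Qed.

Variable M : lmodType R.
Hypothesis M_inj : forall s (y : M), val s *: y = 0 -> y = 0.
Hypothesis M_surj : forall s (y : M), exists y', val s *: y' = y.
Implicit Types (x y : M).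

(** The R_p-structure on M is carried by a bare function; by [M_inj] the equation determines it. *)
Lemma frac_action_ex : exists act : Rp -> M -> M,
  forall a s y, val s *: act (frac (a, s)) y = a *: y.
Proof.
have [inv hinv] := choice (fun sy : denom p * M => M_surj sy.1 sy.2).
exists (fun c y => inv ((repr c).2, (repr c).1 *: y)) => a s y.
have [t /=] := loc_reprP (a, s); have := hinv ((repr (frac (a, s))).2, (repr (frac (a, s))).1 *: y).
case: (repr _) => b r /= hr E; apply/eqP; rewrite -subr_eq0; apply/eqP.
apply: (M_inj (s := t)); apply: (M_inj (s := r)).
set w := inv _ in hr *.
have -> : val r *: (val t *: (val s *: w - a *: y)) =
    (val t * val s) *: (val r *: w) - (val t * (a * val r)) *: y.
  by rewrite !scalerBr !scalerA; congr (_ *: _ - _ *: _); ring.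
by rewrite hr scalerA -E -mulrA [val s * _]mulrC subrr.
Qed.

Variable act : Rp -> M -> M.
Hypothesis actE : forall a s y, val s *: act (frac (a, s)) y = a *: y.

Lemma scaler_denomI s : injective (fun y => val s *: y).
Proof.
move=> x y /eqP; rewrite -subr_eq0 -scalerBr => /eqP /M_inj /eqP.
by rewrite subr_eq0 => /eqP.
Qed.

Lemma act_linear c : exists h : {linear M -> M}, forall y, h y = act c y.
Proof.
apply: linear_of => a x y; have [b [s ->]] := fracP c; apply: (@scaler_denomI s).
by rewrite scalerDr scalerA [_ * a]mulrC -scalerA !actE scalerDr !scalerA mulrC.
Qed.

Lemma actD c d y : act (c + d) y = act c y + act d y.
Proof.
have [a [s ->]] := fracP c; have [b [t ->]] := fracP d.
rewrite fracD; apply: (@scaler_denomI (denomM s t)); rewrite actE /= scalerDr.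
have swap (x : M) : (val s * val t) *: x = val t *: (val s *: x).
  by rewrite scalerA mulrC.
rewrite {1}swap -[in RHS]scalerA !actE scalerDl !scalerA.
by rewrite [val t * _]mulrC [val s * _]mulrC.
Qed.

Lemma act_mul c d y : act (c * d) y = act c (act d y).
Proof.
have [a [s ->]] := fracP c; have [b [t ->]] := fracP d.
rewrite fracM; apply: (@scaler_denomI (denomM s t)); rewrite actE /=.
by rewrite [val s * _]mulrC -[RHS]scalerA actE [RHS]scalerA [_ * a]mulrC -!scalerA actE.
Qed.

Lemma act_to_loc a y : act (to_loc p a) y = a *: y.
Proof. by rewrite -[LHS]scale1r -[1]/(val (denom1 p)) actE. Qed.

Lemma actB c d y : act (c - d) y = act c y - act d y.
Proof. by have := actD (c - d) d y; rewrite subrK => ->; rewrite addrK. Qed.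

Lemma act_pow0 n c y : c \in ideal_pow (loc_max p) n ->
  (forall b, b \in ideal_pow P n -> b *: y = 0) -> act c y = 0.
Proof.
move=> /frac_powP [a [s [-> Pa]]] hy.
by apply: (M_inj (s := s)); rewrite actE hy.
Qed.

End FractionAction.

(** * From a one-dimensional dual to the completion *)

(** Gives a meaning to multiplication by the limit of a Cauchy sequence: on torsion elements the
    values stabilise. *)
Lemma eventually_constant_linear (R : comNzRingType) (A B : lmodType R)
    (F : nat -> {linear A -> B}) :
  (forall y, exists N, forall n, (N <= n)%N -> F n y = F N y) ->
  exists f : {linear A -> B}, forall y, exists N, forall n, (N <= n)%N -> F n y = f y.
Proof.
move=> hF; have [N hN] := choice hF.
have [|f hf] := @linear_of R A B (fun y => F (N y) y).
  move=> a x y; pose k := maxn (N (a *: x + y)) (maxn (N x) (N y)).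
  rewrite -(hN _ k) ?leq_maxl // linearP (hN x) ?(hN y) //.
    by rewrite /k !leq_max leqnn ?orbT.
  by rewrite /k !leq_max leqnn ?orbT.
by exists f => y; exists (N y) => n /hN ->; rewrite hf.
Qed.

Section OneDimensionalDual.
Variables (R : comNzRingType) (R_noeth : noetherian R) (p : prime_idealr R).
Local Notation P := (p : pred R).
Local Notation Rp := (localization p).
Local Notation frac := (\pi_(localization p)).
Variables (Ep : lmodType R) (u : Ep).
Hypothesis Ep_inj : injective_module Ep.
Hypothesis u0 : forall r, r *: u = 0 <-> r \in P.
Hypothesis u_ess : forall y : Ep, y != 0 ->
  exists r t, r *: y = t *: u /\ t \notin P.

Let torsion n (y : Ep) := forall b, b \in ideal_pow P n -> b *: y = 0.

Lemma prime_hull_torsion y : exists n, torsion n y.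
Proof. exact: (hull_torsion R_noeth u0 u_ess). Qed.

Lemma prime_hull_inj (s : denom p) (y : Ep) : val s *: y = 0 -> y = 0.
Proof. exact: (hull_scaler_inj (@prime_idealrP R p) u0 u_ess (valP s)). Qed.

Lemma prime_hull_surj (s : denom p) (y : Ep) : exists y', val s *: y' = y.
Proof.
exact: (hull_scaler_surj (@prime_idealrP R p) Ep_inj u0 u_ess y (valP s)).
Qed.

Variable act : Rp -> Ep -> Ep.
Hypothesis actE : forall a (s : denom p) y, val s *: act (frac (a, s)) y = a *: y.
Variables (E : lmodType R) (phi : {linear Ep -> E}).
Hypothesis E_inj : injective_module E.
Hypothesis phi_u : exists2 y, (forall b, b \in P -> b *: y = 0) & phi y <> 0.
Hypothesis phi_gen : forall f : {linear Ep -> E}, exists (s : denom p) (a : R),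
  forall y, (forall b, b \in P -> b *: y = 0) -> val s *: f y = a *: phi y.

(* If c is not in the n-th power, some y killed by p^n has a multiple c y' equal to *)
(* the element of Q on which phi does not vanish.                                  *)
Lemma phi_act_pow n c : (forall y, torsion n y -> phi (act c y) = 0) ->
  c \in ideal_pow (loc_max p) n.
Proof.
move=> hc; apply: contrapT => cn; have [a [s Ec]] := fracP c.
pose J r := exists t : denom p, val t * r \in ideal_pow P n.
have hJ : is_ideal J := saturated_pow p n.
have Jsat (t : denom p) r : J (val t * r) -> J r.
  by move=> [t' h]; exists (denomM t' t); rewrite -mulrA.
have Ja : ~ J a.
  move=> [t Pta]; apply: cn; rewrite Ec.
  rewrite (@frac_eq _ _ _ _ (val t * a) (denomM t s)) ?frac_pow //=; ring.
have [r Jra|y [Jy ay]] := @injective_cogenerator _ _ Ep_inj J u a hJ.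
  apply/u0; apply: contrapT => /negP rP; apply: Ja.
  exact: (Jsat (Sub r rP)).
have [w Pw] := phi_u; apply.
have [t [r [tP tw]]] := hull_socle u0 u_ess Pw.
have scaleC (M : lmodType R) a1 a2 (v : M) : a1 *: (a2 *: v) = a2 *: (a1 *: v).
  by rewrite !scalerA mulrC.
(* As c = a / s, a y = u and t w = r u, the element y' = (r s / t) y satisfies c y' = (r / t) u =
   w. *)
have [y' /= Ey'] := prime_hull_surj (Sub t tP) ((r * val s) *: y).
have Ew : act c y' = w.
  apply: (scaler_denomI prime_hull_inj (s := denomM (Sub t tP) s)) => /=.
  rewrite -!scalerA Ec actE scaleC Ey' scaleC ay [RHS]scaleC tw.
  by rewrite [RHS]scalerA mulrC.
rewrite -Ew; apply: hc => b Pb.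
apply: (@prime_hull_inj (Sub t tP)); rewrite /= scaleC Ey' scaleC.
by rewrite Jy ?scaler0 //; exists (denom1 p); rewrite mul1r.
Qed.

(** On Q, f is a fraction c of phi, so f - phi c vanishes there and equals a sum of maps l_i g_i,
    with g_i generating p. If p^(n+1) kills y then p^n kills g_i y, and induction applies to the
    l_i. *)
Lemma phi_approx n (f : {linear Ep -> E}) :
  exists c, forall y, torsion n y -> f y = phi (act c y).
Proof.
elim: n f => [|n IHn] f.
  exists 0 => y ny; have -> : y = 0 by rewrite -[y]scale1r ny ?ideal_pow0.
  have [h hh] := act_linear prime_hull_inj actE 0.
  by rewrite -hh !linear0.
have [s [a fa]] := phi_gen f; pose c := frac (a, s).
have [h hh] := act_linear prime_hull_inj actE c.
have [k [g [gP hg]]] := noetherian_fg R_noeth (idealr_is_ideal p).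
have [G hG] := choice (fun i : 'I_k => mul_linear Ep (g i)).
have [|l hl] := extend_factor_family E_inj (f := G) (g := f \- (phi \o h)).
  move=> w Gw /=; have Pw b : b \in P -> b *: w = 0.
    move=> /hg [d ->]; rewrite scaler_suml big1 // => i _.
    by rewrite -scalerA -hG Gw scaler0.
  have [w' Ew] := prime_hull_surj s w.
  have Pw' b : b \in P -> b *: w' = 0.
    move=> Pb; apply: (@prime_hull_inj s).
    by rewrite scalerA mulrC -scalerA Ew Pw.
  rewrite hh -{1}Ew linearZ /= fa // -linearZ /=.
  apply/eqP; rewrite subr_eq0; apply/eqP; congr (phi _).
  apply: (scaler_denomI prime_hull_inj (s := s)).
  by rewrite actE -Ew !scalerA mulrC.
have [d hd] := choice (fun i => IHn (l i)).
exists (c + \sum_i d i * to_loc p (g i)) => y ny.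
have actS (I : seq 'I_k) : phi (act (\sum_(i <- I) d i * to_loc p (g i)) y) =
    \sum_(i <- I) phi (act (d i) (g i *: y)).
  elim: I => [|i I IHI]; first by rewrite !big_nil -[0]/(to_loc p 0) (act_to_loc actE) scale0r linear0.
  by rewrite !big_cons (actD prime_hull_inj actE) linearD /= IHI (act_mul prime_hull_inj actE) (act_to_loc actE).
rewrite (actD prime_hull_inj actE) linearD /= actS -hh.
have -> : \sum_i phi (act (d i) (g i *: y)) = \sum_i l i (G i y).
  apply: eq_bigr => i _; rewrite hG -hd // => b Pb.
  by rewrite scalerA mulrC; apply: ny; apply: ideal_pow_mem.
by rewrite -hl /= addrC subrK.
Qed.

Let represents (x : nat -> Rp) (f : Ep -> E) :=
  forall y, exists N, forall n, (N <= n)%N -> phi (act (x n) y) = f y.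

Lemma cauchy_represents (x : nat -> Rp) : adic_cauchy (loc_max p) x ->
  exists f : {linear Ep -> E}, represents x f.
Proof.
move=> xC; have [h hh] := choice (act_linear prime_hull_inj actE).
have [|f hf] := @eventually_constant_linear _ _ _ (fun n => phi \o h (x n)).
  move=> y; have [k ky] := prime_hull_torsion y; have [N hN] := xC k.
  exists N => n Nn /=; rewrite !hh; congr (phi _).
  apply/eqP; rewrite -subr_eq0 -(actB prime_hull_inj actE).
  by rewrite (act_pow0 prime_hull_inj actE (hN _ _ Nn (leqnn N)) ky).
by exists f => y; have [N hN] := hf y; exists N => n /hN /=; rewrite hh.
Qed.

(* No recursion is needed: approximations chosen independently for each n form a *)
(* Cauchy sequence by phi_act_pow.                                                *)
Lemma represents_cauchy (f : {linear Ep -> E}) :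
  exists x, adic_cauchy (loc_max p) x /\ represents x f.
Proof.
have [x hx] := choice (fun n => phi_approx n f).
have torsion_le k n y : (k <= n)%N -> torsion k y -> torsion n y.
  by move=> kn ky b /(ideal_pow_le kn); apply: ky.
exists x; split=> [k|y].
  exists k => i j ki kj; apply: phi_act_pow => y ky.
  rewrite (actB prime_hull_inj actE) linearB /= -!hx ?subrr //.
    exact: torsion_le ky.
  exact: torsion_le ky.
have [k ky] := prime_hull_torsion y; exists k => n kn.
by rewrite -hx //; apply: torsion_le ky.
Qed.

(** A Cauchy sequence acts on all elements killed by p^k as a constant from one common index on, so
    the pointwise limit 0 is attained there uniformly and [phi_act_pow] applies. *)
Lemma represents_null (x : nat -> Rp) : adic_cauchy (loc_max p) x ->
  represents x (fun=> 0) <-> adic_cvg (loc_max p) x 0.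
Proof.
move=> xC; split=> [x0 k|x0 y].
  have [N hN] := xC k; exists N => i Ni; rewrite subr0; apply: phi_act_pow => y ky.
  have [N' hN'] := x0 y; rewrite -(hN' (maxn N N')) ?leq_maxr //; congr (phi _).
  apply/eqP; rewrite -subr_eq0 -(actB prime_hull_inj actE).
  by rewrite (act_pow0 prime_hull_inj actE (hN _ _ Ni (leq_maxl _ _)) ky).
have [k ky] := prime_hull_torsion y; have [N hN] := x0 k; exists N => n /hN.
by rewrite subr0 => xk; rewrite (act_pow0 prime_hull_inj actE xk ky) linear0.
Qed.

Lemma represents_linear a (x y : nat -> Rp) (f g : {linear Ep -> E}) :
  represents x f -> represents y g ->
  represents (fun n => to_loc p a * x n + y n) (fun w => a *: f w + g w).
Proof.
move=> xf yg w; have [N hN] := xf w; have [N' hN'] := yg w.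
exists (maxn N N') => n; rewrite geq_max => /andP[/hN <- /hN' <-].
rewrite (actD prime_hull_inj actE) (act_mul prime_hull_inj actE).
by rewrite (act_to_loc actE) linearP.
Qed.

Lemma representsB (x y : nat -> Rp) (f : {linear Ep -> E}) :
  represents x f -> represents y f -> represents (fun n => x n - y n) (fun=> 0).
Proof.
move=> xf yg w; have [N hN] := xf w; have [N' hN'] := yg w.
exists (maxn N N') => n; rewrite geq_max => /andP[/hN Ex /hN' Ey].
by rewrite (actB prime_hull_inj actE) linearB /= Ex Ey subrr.
Qed.

Local Notation pi := (\pi_{ideal_quot null_ideal (loc_max p)}).

(** Sends f to the class of a chosen representing sequence; linearity holds because such sequences
    are unique up to null sequences. *)
Lemma completion_iso : module_iso (module_hom Ep E)
  (restr (to_completion (loc_max p) \o to_loc p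
           : {rmorphism R -> completion (loc_max p)})).
Proof.
have rep (f : module_hom Ep E) : exists x : cauchy_seq (loc_max p), represents (val x) f.
  have [x [/asboolP xC xf]] := represents_cauchy f.
  by exists (Sub x xC); rewrite SubK.
have [k hk] := choice rep.
have cauchy (x : cauchy_seq (loc_max p)) : adic_cauchy (loc_max p) (val x).
  by case: x => x /= /asboolP.
have pi_eq (x y : cauchy_seq (loc_max p)) :
    represents (fun n => val x n - val y n) (fun=> 0) <-> pi x = pi y.
  have E1 : (pi x = pi y) <-> (x - y \in null_ideal (loc_max p)).
    by rewrite Quotient.idealrBE; split=> [->|/eqP].
  rewrite E1; have := represents_null (cauchy (x - y)).
  by move=> h; split=> [/h /asboolP|/asboolP /h].
pose F (f : module_hom Ep E) : restr (to_completion (loc_max p) \o to_loc p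
           : {rmorphism R -> completion (loc_max p)}) := pi (k f).
have [|h hF] := @linear_of _ _ _ F.
  move=> a f g; rewrite /F.
  transitivity (pi (cst_seq (loc_max p) (to_loc p a) * k f + k g)); last first.
    by rewrite rmorphD rmorphM.
  apply/pi_eq; apply: (representsB (f := a *: f + g)); first exact: hk.
  exact: (represents_linear a (hk f) (hk g)).
exists h.
have h_inj : injective h.
  move=> f g; rewrite !hF => /pi_eq fg; apply: homP => y.
  have [N1 h1] := hk f y; have [N2 h2] := hk g y; have [N3 h3] := fg y.
  pose n := maxn N1 (maxn N2 N3).
  rewrite -(h1 n) -?(h2 n) ?leq_max ?leqnn ?orbT //.
  apply/eqP; rewrite -subr_eq0 -linearB -(actB prime_hull_inj actE) /= h3 //.
  by rewrite !leq_max leqnn ?orbT.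
have h_surj c : exists f, h f = c.
  elim/quotW: c => x; have [f xf] := cauchy_represents (cauchy x).
  by exists f; rewrite hF; apply/pi_eq; apply: representsB (hk f) xf.
have [g hg] := choice h_surj.
by exists g => [f|c //]; apply: h_inj; rewrite hg.
Qed.

End OneDimensionalDual.

(** * Dimension one *)

Section QuotientByPrime.
Variables (R : comNzRingType) (p : prime_idealr R).
Local Notation P := (p : pred R).
Local Notation D := {ideal_quot p}.
Local Notation pi := (\pi_{ideal_quot p} : {rmorphism R -> D}).

Lemma pi_eq a b : pi a = pi b <-> a - b \in P.
Proof. by rewrite Quotient.idealrBE; split=> [/eqP|/eqP]. Qed.

Lemma pi_surj (d : D) : exists a, d = pi a.
Proof. by exists (repr d); rewrite /= reprK. Qed.

Lemma pi_in_ideal_pow (I : idealr R) n a :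
  pi a \in ideal_pow (ideal_ext pi (I : pred R)) n <->
  exists2 b, b \in ideal_pow (I : pred R) n & a - b \in P.
Proof.
split=> [|[b Ib /pi_eq ->]].
  have : forall n d, d \in ideal_pow (ideal_ext pi (I : pred R)) n ->
      exists2 b, b \in ideal_pow (I : pred R) n & d = pi b.
    apply: ideal_pow_rec => [{}n||{}n d e].
    - split=> [|_ _ [b Ib ->] [c Ic ->]|d _ [b Ib ->]].
      + by exists 0; rewrite ?ideal_pow_0 ?rmorph0.
      + by exists (b + c); rewrite ?ideal_powD ?rmorphD.
      + have [c ->] := pi_surj d.
        by exists (c * b); rewrite ?ideal_powMl ?rmorphM.
    - by exists 1; rewrite ?ideal_pow0 ?rmorph1.
    - move=> /asboolP [k [c [b [Ib ->]]]] [e' Ie ->].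
      have [c' hc] := choice (fun i => pi_surj (c i)).
      exists ((\sum_i c' i * b i) * e').
        apply: ideal_pow_mem => //; apply: rpred_sum => i _; exact: idealMr.
      rewrite rmorphM; congr (_ * _); rewrite rmorph_sum; apply: eq_bigr => i _.
      by rewrite rmorphM hc.
  by move=> /[apply] -[b Ib /pi_eq ab]; exists b.
move: n b Ib; apply: ideal_pow_rec => [n||n b c Ib Ic].
- split=> [|b c Ib Ic|b c Ic]; rewrite ?rmorph0 ?rmorphD ?rmorphM.
  + exact: ideal_pow_0.
  + exact: ideal_powD.
  + exact: ideal_powMl.
- exact: ideal_pow0.
- rewrite rmorphM; apply: ideal_pow_mem => //; apply/asboolP.
  by exists 1%N, (fun=> 1), (fun=> b); split=> //; rewrite big_ord1 mul1r.
Qed.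

Lemma quotient_prime (J : R -> Prop) : is_ideal J -> ~ J 1 ->
  (forall a b, J (a * b) -> J a \/ J b) -> (forall a, a \in P -> J a) ->
  exists Q : prime_idealr D, forall a, pi a \in (Q : pred D) <-> J a.
Proof.
move=> hJ J1 Jpr PJ; pose K d := exists2 a, d = pi a & J a.
have KP a : K (pi a) <-> J a.
  split=> [[b /pi_eq /PJ Jab Jb]|Ja]; last by exists a.
  by rewrite -[a](subrK b); apply: is_idealD.
have [|||Q hQ] := @prime_idealr_of_prime D K.
- split=> [|_ _ [a -> Ja] [b -> Jb]|d _ [b -> Jb]].
  + by exists 0; [rewrite rmorph0|apply: is_ideal0 hJ].
  + by exists (a + b); [rewrite rmorphD|apply: is_idealD].
  + have [a ->] := pi_surj d.
    by exists (a * b); [rewrite rmorphM|apply: is_idealM].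
- by rewrite -(rmorph1 pi) => /KP.
- move=> d e; have [a ->] := pi_surj d; have [b ->] := pi_surj e.
  by rewrite -rmorphM => /KP /Jpr [/KP ?|/KP ?]; [left|right].
- by exists Q => a; rewrite hQ; split=> [/asboolP /KP|/KP Ja]; last exact/asboolP.
Qed.

Variable m : idealr R.
Hypotheses (R_noeth : noetherian R) (R_local : local_ring m).
Hypothesis dim_p : krull_dim_eq D 1.

Lemma prime_sub_local a : a \in P -> a \in (m : pred R).
Proof.
apply: (proper_sub_local R_noeth R_local (idealr_is_ideal p)).
by rewrite idealr1.
Qed.

(** If m were contained in p, all primes of R/p would be zero. *)
Lemma dim1_parameter : exists2 x, x \in (m : pred R) & x \notin P.
Proof.
have [[Q /(_ 0%N isT) [Q01 Q10]] _] := dim_p.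
apply: contrapT => mp; apply: Q10 => d; have [a ->] := pi_surj d => Qa.
have ma : a \in (m : pred R).
  apply: (proper_sub_local R_noeth R_local (J := fun r => pi r \in (Q 1%N : pred D))) Qa.
    split=> [|b c|b c]; rewrite ?rmorph0 ?rmorphD ?rmorphM.
    + by move=> *; apply: idealr0.
    + exact: rpredD.
    + exact: idealMr.
  by rewrite rmorph1 idealr1.
suff -> : pi a = pi 0 by rewrite rmorph0 idealr0.
apply/pi_eq; rewrite subr0; case: (boolP (a \in P)) => // aP.
by case: mp; exists a.
Qed.

(** Otherwise [associated_prime] yields a prime q containing J and x but not m, and p < q < m is too
    long a chain. *)
Lemma dim1_primary (J : R -> Prop) x : is_ideal J ->
  (forall a, a \in P -> J a) -> J x -> x \notin P ->
  exists n, forall b, b \in ideal_pow (m : pred R) n -> J b.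
Proof.
move=> hJ PJ Jx xP; apply: contrapT => nJ.
have [|b [Jb q_prime [y my Jyb]]] := associated_prime R_noeth (idealr_is_ideal m) hJ.
  by move=> n hn; apply: nJ; exists n.
have Jq a : J a -> J (a * b) by move=> Ja; rewrite mulrC; apply: is_idealM.
have [||//|Q0 hQ0] := @quotient_prime (fun r => r \in P) (idealr_is_ideal p).
- by rewrite idealr1.
- exact: prime_idealrP.
have [|//||Q1 hQ1] := @quotient_prime _ (colon_is_ideal b hJ).
- by rewrite mul1r.
- by move=> a /PJ /Jq.
have [|||Q2 hQ2] := @quotient_prime (fun r => r \in (m : pred R)) (idealr_is_ideal m).
- by rewrite idealr1.
- exact: local_prime.
- exact: prime_sub_local.
have : prime_chain D 2.
  exists (fun i => if i is i'.+1 then if i' is _.+1 then Q2 else Q1 else Q0).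
  case=> [|[|//]] _ /=; split.
  - by move=> d; have [a ->] := pi_surj d => /hQ0 /PJ /Jq /hQ1.
  - move=> Q10; have /Q10 /hQ0 : pi x \in (Q1 : pred D) by apply/hQ1/Jq.
    exact/negP.
  - move=> d; have [a ->] := pi_surj d => /hQ1 Jab; apply/hQ2.
    apply: (proper_sub_local R_noeth R_local (colon_is_ideal b hJ)) Jab.
    by rewrite mul1r.
  - by move=> Q21; apply/Jyb/hQ1/Q21/hQ2.
by move=> /dim_p.2.
Qed.

End QuotientByPrime.

(** * The dual of the fraction field over a complete quotient *)

Section DualOfResidueField.
Variables (R : comNzRingType) (m : idealr R) (p : prime_idealr R).
Hypotheses (R_noeth : noetherian R) (R_local : local_ring m).
Local Notation P := (p : pred R).
Local Notation m' := (m : pred R).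
Local Notation D := {ideal_quot p}.
Local Notation pi := (\pi_{ideal_quot p} : {rmorphism R -> D}).
Variables (E : lmodType R) (z : E).
Hypothesis E_inj : injective_module E.
Hypothesis z0 : forall r, r *: z = 0 <-> r \in m'.
Hypothesis z_ess : forall y : E, y != 0 ->
  exists r t, r *: y = t *: z /\ t \notin m'.
Variables (Ep : lmodType R) (u : Ep).
Hypothesis Ep_inj : injective_module Ep.
Hypothesis u0 : forall r, r *: u = 0 <-> r \in P.
Hypothesis u_ess : forall y : Ep, y != 0 ->
  exists r t, r *: y = t *: u /\ t \notin P.

Let killed (M : lmodType R) (y : M) := forall b, b \in P -> b *: y = 0.
(** The ideal m^n + p, the preimage of the n-th power of m/p. *)
Let pow_p n r := exists2 b, b \in ideal_pow m' n & r - b \in P.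

Let scaleC (M : lmodType R) a b (y : M) : a *: (b *: y) = b *: (a *: y).
Proof. by rewrite !scalerA mulrC. Qed.

Let pow_p_ideal n : is_ideal (pow_p n).
Proof. exact: add_ideal_is_ideal (ideal_pow_is_ideal _ _) (idealr_is_ideal p). Qed.

Let pow_p_kills n r (e : E) : (forall b, b \in ideal_pow m' n -> b *: e = 0) ->
  killed e -> pow_p n r -> r *: e = 0.
Proof.
by move=> ne Pe [b mb Prb]; rewrite -[r](subrK b) scalerDl Pe // ne // addr0.
Qed.

Lemma socle_divisible (s : R) (y : Ep) : s \notin P -> killed y ->
  exists2 y', killed y' & s *: y' = y.
Proof.
move=> sP Py.
have [y' Ey] := hull_scaler_surj (@prime_idealrP R p) Ep_inj u0 u_ess y sP.
exists y' => // b Pb; apply: (hull_scaler_inj (@prime_idealrP R p) u0 u_ess sP).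
by rewrite scaleC Ey Py.
Qed.

Lemma killed_lin (M : lmodType R) a (x y : M) :
  killed x -> killed y -> killed (a *: x + y).
Proof. by move=> Px Py b Pb; rewrite scalerDr scaleC Px // Py // scaler0 addr0. Qed.

Lemma killed0 (M : lmodType R) : killed (0 : M).
Proof. by move=> b _; rewrite scaler0. Qed.

Lemma killed_linear (M N : lmodType R) (f : {linear M -> N}) y :
  killed y -> killed (f y).
Proof. by move=> Py b Pb; rewrite -linearZ /= Py // linear0. Qed.

Lemma killed_u : killed u.
Proof. by move=> b /u0. Qed.

Section Complete.
Hypothesis D_complete : adic_complete (ideal_ext pi m').
Hypothesis dim_p : krull_dim_eq D 1.

(** Let s n be a finite set with annihilator m^n + p, and d n a scalar equal to h on s 0, ..., s n.
    Agreement on s n makes d Cauchy modulo p, and its limit is the scalar sought. *)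
Lemma endomorphism_scalar (h : {linear E -> E}) :
  exists d : R, forall e, killed e -> h e = d *: e.
Proof.
have [s hs] := choice (fun n => finite_annihilator R_noeth R_local E_inj z0
  (pow_p_ideal n) (fun b mb => ex_intro2 _ _ b mb
     (eq_ind_r (fun x => x \in P) (idealr0 p) (subrr b)))).
pose t n := flatten [seq s i | i <- iota 0 n.+1].
have st n k x : (n <= k)%N -> x \in s n -> x \in t k.
  by move=> nk xs; apply/flatten_mapP; exists n; rewrite ?mem_iota.
have lsc := endomorphism_locally_scalar R_noeth R_local E_inj z0 z_ess.
have [d hd] := choice (fun n => lsc (t n) h).
have [l [ld _]] : exists! l, adic_cvg (ideal_ext pi m') (fun n => pi (d n)) l.
  apply: D_complete => n; exists n => i j ni nj; rewrite -rmorphB.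
  apply/pi_in_ideal_pow/hs => e es; rewrite scalerBl.
  by rewrite -(hd i) ?(st n) // -(hd j) ?(st n) // subrr.
move: ld; have [a ->] := pi_surj l => da; exists a => e Pe.
have [n ne] := residue_torsion R_noeth z0 z_ess e.
have [N hN] := da n; pose k := maxn n N.
(* The scalar c links e to the sets: c - d k kills s n, so it lies in m^n + p and kills e. *)
have [c hc] := lsc (e :: t k) h; rewrite hc ?mem_head //.
suff [E1 E2] : (c - d k) *: e = 0 /\ (d k - a) *: e = 0.
  apply/eqP; rewrite -subr_eq0 -scalerBl -[c](subrK (d k)) -addrA scalerDl E1 E2.
  by rewrite addr0.
split; apply: (pow_p_kills ne Pe); last first.
  by apply/pi_in_ideal_pow; rewrite rmorphB; apply: hN; apply: leq_maxr.
apply/hs => x /(st n k _ (leq_maxl _ _)) xt.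
by rewrite scalerBl -(hd k) // -hc ?subrr // inE xt orbT.
Qed.

(** If e were not in f(Q), some endomorphism would kill f(Q) and map e to z. On E_p it is a scalar
    d, nonzero modulo p as d e = z; but Q is divisible by d, so f would vanish on Q. *)
Lemma socle_image (f : {linear Ep -> E}) y0 : killed y0 -> f y0 <> 0 ->
  forall e, killed e -> exists2 y, killed y & f y = e.
Proof.
move=> Py0 fy0 e Pe; apply: contrapT => ne.
have [|F hF] := @linear_of R (Ep * R^o)%type E (fun w => f w.1 + (w.2 : R) *: e).
  move=> a [x b] [y c] /=; rewrite linearP /= scalerDl scalerDr addrACA.
  by rewrite [a *: (b : R^o)]/(a * b) scalerA.
have [|G hG] := @linear_of R (Ep * R^o)%type E (fun w => (w.2 : R) *: z).
  by move=> a [x b] [y c] /=; rewrite scalerDl [a *: (b : R^o)]/(a * b) scalerA.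
have [||[y r] /= Py|h hh] := @extend_factor_on R E E_inj (Ep * R^o)%type E
  (fun w => killed w.1) F G.
- exact: (@killed0 Ep).
- by move=> a x y; apply: (@killed_lin Ep).
- rewrite hF hG /= => /eqP; rewrite addrC addr_eq0 => /eqP re.
  case: (boolP ((r : R) \in m')) => [/z0 //|/(local_inv R_noeth R_local) [c cr]].
  case: ne; exists (- c *: y).
    by rewrite -[_ *: y]addr0; apply: killed_lin => //; apply: killed0.
  by rewrite linearZ /= scaleNr -scalerN -re scalerA cr scale1r.
have [d hd] := endomorphism_scalar h.
have he : h e = z.
  have := hh (0, 1) (@killed0 Ep).
  by rewrite hF hG /= linear0 add0r !scale1r.
have hf y : killed y -> h (f y) = 0.
  by move=> Py; have := hh (y, 0) Py; rewrite hF hG /= !scale0r addr0.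
apply: (residue_generator_neq0 z0); rewrite -he hd // Pe //.
case: (boolP (d \in P)) => // dP; case: fy0.
have [y1 Py1 <-] := socle_divisible dP Py0.
by rewrite linearZ /= -hd ?hf //; apply: killed_linear.
Qed.

(** Q is the union of the chain R v_n, where v_n = x^-n u for a parameter x; the point is to bound
    the kernel of f on Q by one term of this chain. *)
Lemma socle_dual_dim1 (f : {linear Ep -> E}) y0 : killed y0 -> f y0 <> 0 ->
  forall g : {linear Ep -> E}, exists (s : denom p) (a : R),
  forall y, killed y -> val s *: g y = a *: f y.
Proof.
move=> Py0 fy0 g.
have [x mx xP] := dim1_parameter R_noeth R_local dim_p.
have xnP n : x ^+ n \notin P.
  elim: n => [|n IHn]; first by rewrite expr0 idealr1.
  by rewrite exprS prime_idealrM negb_or xP.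
have Ep_can s (y y' : Ep) : s \notin P -> s *: y = s *: y' -> y = y'.
  move=> sP E'; apply/eqP; rewrite -subr_eq0; apply/eqP.
  apply: (hull_scaler_inj (@prime_idealrP R p) u0 u_ess sP).
  by rewrite scalerBr E' subrr.
have [div hdiv] : exists div : Ep -> Ep,
    forall y, killed y -> killed (div y) /\ x *: div y = y.
  have : forall y : Ep, exists y', killed y -> killed y' /\ x *: y' = y.
    move=> y; have [Py|nPy] := pselect (killed y); last by exists 0.
    by have [y' Py' Ey] := socle_divisible xP Py; exists y'.
  by move=> /choice [div]; exists div.
pose v n := iter n div u.
have Pv n : killed (v n).
  by elim: n => [|n IHn]; [apply: killed_u|case: (hdiv _ IHn)].
have vS n : x *: v n.+1 = v n by case: (hdiv _ (Pv n)).
have vD n k : x ^+ k *: v (k + n)%N = v n.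
  elim: k => [|k IHk]; first by rewrite expr0 scale1r.
  by rewrite exprSr -scalerA addSn vS.
pose J (s a : R) := exists2 b : R, (exists c : R, b = c * s) & a - b \in P.
have hJ s : is_ideal (J s) :=
  add_ideal_is_ideal (principal_is_ideal s) (idealr_is_ideal p).
have PJ s a : a \in P -> J s a.
  by exists 0; rewrite ?subr0 //; exists 0; rewrite mul0r.
have primary s : s \notin P -> exists n, forall b, b \in ideal_pow m' n -> J s b.
  apply: (dim1_primary R_noeth R_local dim_p (hJ s) (PJ s)).
  by exists s; rewrite ?subrr ?idealr0 //; exists 1; rewrite mul1r.
(* Some x^n lies in s R + p, which turns the denominator s into x^n. *)
have gen y : killed y -> exists n r, y = r *: v n.
  move=> Py; have [s [r [sP sy]]] := hull_socle u0 u_ess Py.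
  have [n hn] := primary _ sP.
  have [_ [c ->] Pxc] := hn _ (ideal_pow_exp n mx).
  exists n, (c * r); apply: (Ep_can _ _ _ (xnP n)).
  have -> : x ^+ n *: ((c * r) *: v n) = (c * r) *: u.
    by rewrite scaleC; have := vD 0%N n; rewrite addn0 => ->.
  rewrite -[x ^+ n](subrK (c * s)) scalerDl Py // add0r.
  by rewrite -!scalerA sy.
(* x R + p is the annihilator of a finite subset of E_p = f(Q); one R f(v_N) contains this
   subset. *)
have [k hk] := primary _ xP.
have [s hs] := finite_annihilator R_noeth R_local E_inj z0 (hJ x) hk.
have [N hN] : exists N, forall e, e \in s -> exists r, e = r *: f (v N).
  have sP e : e \in s -> exists n r, e = r *: f (v n).
    move=> es; have Pe : killed e by move=> b Pb; apply: ((hs b).1 _ _ es); apply: PJ.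
    have [y /gen [n [r ->]] <-] := socle_image Py0 fy0 Pe.
    by exists n, r; rewrite linearZ.
  elim: s {hs} sP => [|e s IHs] sP; first by exists 0%N.
  have [|N hN] := IHs; first by move=> x' xs; apply: sP; rewrite inE xs orbT.
  have [n [r Ee]] := sP e (mem_head _ _); exists (maxn N n).
  have up i r' : (i <= maxn N n)%N -> exists r'', r' *: f (v i) = r'' *: f (v (maxn N n)).
    move=> ile; exists (r' * x ^+ (maxn N n - i)).
    by rewrite -(vD i (maxn N n - i)%N) subnK // linearZ scalerA.
  move=> e'; rewrite inE => /predU1P [->|/hN [r' ->]].
    by rewrite Ee; apply: up; rewrite leq_maxr.
  by apply: up; rewrite leq_maxl.
have ann j r : r *: f (v (j + N)%N) = 0 -> J x r.
  move=> rv; apply/hs => e /hN [r' ->].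
  have -> : f (v N) = x ^+ j *: f (v (j + N)%N) by rewrite -linearZ vD.
  by rewrite 2!(scaleC r) rv !scaler0.
(* The kernel of f on Q is contained in R v_N, where v_N = x^-N u. *)
have bound j r : f (r *: v (j + N)%N) = 0 -> exists c, r *: v (j + N)%N = c *: v N.
  elim: j r => [|j IHj] r frv; first by exists r.
  have /ann [_ [c ->] Prc] : r *: f (v (j.+1 + N)%N) = 0 by rewrite -linearZ.
  have Er : r *: v (j.+1 + N)%N = c *: v (j + N)%N.
    rewrite -[r](subrK (c * x)) scalerDl [X in X + _]Pv // add0r -scalerA.
    by rewrite addSn vS.
  by have [|c' hc'] := IHj c; [rewrite -Er|exists c'; rewrite Er].
(* Since x^n kills g(v_N), the map x^n g vanishes on the kernel of f on Q and factors through f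
   there. *)
have [n hn] := residue_torsion R_noeth z0 z_ess (g (v N)).
have [t ht] := mul_linear E (x ^+ n).
have [|||h hh] := @extend_factor_on R E E_inj Ep E (fun y => killed y) f (t \o g).
- exact: (@killed0 Ep).
- by move=> a y y'; apply: (@killed_lin Ep).
- move=> y /gen [i [r ->]]; rewrite -(vD i N) addnC scalerA => /bound [c ->].
  by rewrite /= ht linearZ /= scaleC hn ?scaler0 //; apply: ideal_pow_exp.
have [d hd] := endomorphism_scalar h.
exists (Sub (x ^+ n) (xnP n)), d => y Py.
by rewrite -hd ?hh /= ?ht //; apply: killed_linear.
Qed.

End Complete.

End DualOfResidueField.

(** * From the completion to a one-dimensional dual *)

Section CompletionModuloIdeal.
Variables (A : comNzRingType) (I : idealr A) (k : nat) (g : 'I_k -> A).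
Local Notation J := (I : pred A).
Hypothesis g_gen : forall r, r \in J <-> exists c : 'I_k -> A, r = \sum_i c i * g i.

Lemma ideal_pow_decomposition n r : r \in ideal_pow J n.+1 ->
  exists d : 'I_k -> A, (forall i, d i \in ideal_pow J n) /\ r = \sum_i d i * g i.
Proof.
move: r; apply: ideal_powSP => [|_ b /g_gen [c ->] Jb].
- split=> [|_ _ [c [Jc ->]] [d [Jd ->]]|a _ [d [Jd ->]]].
  + exists (fun=> 0); split=> [i|]; first exact: ideal_pow_0.
    by rewrite big1 // => i _; rewrite mul0r.
  + exists (fun i => c i + d i); split=> [i|]; first exact: ideal_powD.
    by rewrite -big_split; apply: eq_bigr => i _; rewrite mulrDl.
  + exists (fun i => a * d i); split=> [i|]; first exact: ideal_powMl.
    by rewrite mulr_sumr; apply: eq_bigr => i _; rewrite mulrA.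
- exists (fun i => c i * b); split=> [i|]; first exact: ideal_powMl.
  by rewrite mulr_suml; apply: eq_bigr => i _; rewrite mulrAC.
Qed.

(** Decompose at the largest n <= N with r in J^(n+1); the cap N makes it exist even if r lies in
    every power. *)
Lemma ideal_pow_best_decomposition N r : r \in ideal_pow J 1 ->
  exists d : 'I_k -> A, r = \sum_i d i * g i /\
  forall n, (n <= N)%N -> r \in ideal_pow J n.+1 -> forall i, d i \in ideal_pow J n.
Proof.
elim: N => [|N IHN] r1.
  have [d [_ Er]] := ideal_pow_decomposition r1; exists d; split=> // n.
  by rewrite leqn0 => /eqP -> _ i; apply: ideal_pow0.
have [rN|rN] := boolP (r \in ideal_pow J N.+2).
  have [d [dN Er]] := ideal_pow_decomposition rN; exists d; split=> // n nN _ i.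
  exact: ideal_pow_le (dN i).
have [d [Er hd]] := IHN r1; exists d; split=> // n.
rewrite leq_eqVlt => /predU1P [->|]; last exact: hd.
by rewrite (negPf rN).
Qed.

(** Decompose each difference of consecutive terms as well as possible, and sum the coefficients. *)
Lemma cauchy_sum_decomposition (y : nat -> A) : adic_cauchy J y -> y 0%N = 0 ->
  (forall n, y n \in ideal_pow J 1) ->
  exists c : 'I_k -> nat -> A, (forall i, adic_cauchy J (c i)) /\
    forall n, y n = \sum_i g i * c i n.
Proof.
move=> yC y0 y1.
have [d hd] := choice (fun n => @ideal_pow_best_decomposition n (y n.+1 - y n)
  (ideal_powB (y1 n.+1) (y1 n))).
exists (fun i n => \sum_(j < n) d j i); split=> [i n|n]; last first.
  elim: n => [|n IHn]; first by rewrite y0 big1 // => i _; rewrite big_ord0 mulr0.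
  rewrite -[y n.+1](subrK (y n)) (hd n).1 IHn -big_split; apply: eq_bigr => i _.
  by rewrite big_ord_recr mulrDr addrC [_ * d n i]mulrC.
(* Passing to coefficients loses one power; j at least n keeps n below the cap of the j-th
   decomposition. *)
have [N hN] := yC n.+1; pose M := maxn N n.
have step j : (M <= j)%N -> d j i \in ideal_pow J n.
  rewrite geq_max => /andP[Nj nj]; apply: (hd j).2 => //.
  by apply: hN => //; apply: leqW.
have near_M j : (M <= j)%N ->
    \sum_(l < j) d l i - \sum_(l < M) d l i \in ideal_pow J n.
  move=> /subnK <-; elim: (j - M)%N => [|e IHe]; first by rewrite subrr ideal_pow_0.
  rewrite addSn big_ord_recr /= addrAC ideal_powD //.
  by apply: step; apply: leq_addl.
exists M => a b /near_M Ma /near_M Mb.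
by have := ideal_powB Ma Mb; rewrite opprB addrA subrK.
Qed.

Local Notation pi := (\pi_{ideal_quot null_ideal I}).

(** A Cauchy sequence is a constant plus a Cauchy sequence in J, up to a null sequence, and the
    second part decomposes along the generators of J. *)
Lemma completion_residue (c : completion I) : exists (a : A) (d : 'I_k -> completion I),
  c = to_completion I a + \sum_i to_completion I (g i) * d i.
Proof.
elim/quotW: c => -[x xC']; have /asboolP xC := xC'.
(* The shift by N puts every y n in J and makes y 0 = 0; it changes x only by a null sequence. *)
have [N hN] := xC 1%N; pose y n := x (n + N)%N - x N.
have xy n i j : x i - x j \in ideal_pow J n -> (x i - x N) - (x j - x N) \in ideal_pow J n.
  by rewrite opprB addrA subrK.
have [||n|e [eC ye]] := @cauchy_sum_decomposition y.
- move=> n; have [M hM] := xC n; exists M => i j Mi Mj; apply: xy.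
  by apply: hM; [apply: leq_trans Mi _|apply: leq_trans Mj _]; apply: leq_addr.
- by rewrite /y subrr.
- by apply: hN; rewrite ?leq_addl.
have eC' i : e i \in cauchy_seq_pred I by apply/asboolP.
exists (x N), (fun i => pi (CauchySeq (eC' i))).
transitivity (pi (cst_seq I (x N) + \sum_i cst_seq I (g i) * CauchySeq (eC' i))); last first.
  rewrite rmorphD rmorph_sum; congr (_ + _); apply: eq_bigr => i _.
  by rewrite rmorphM.
apply/eqP; rewrite -Quotient.idealrBE; apply/asboolP => n.
have [M hM] := xC n; exists (maxn M N) => i; rewrite geq_max => /andP[Mi Ni].
rewrite subr0.
have valS : val (\sum_i cst_seq I (g i) * CauchySeq (eC' i)) i = y i.
  rewrite ye; elim/big_ind2: _ => // [a b a' b' <- <- //].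
suff -> : val (CauchySeq xC' - (cst_seq I (x N) +
    \sum_i cst_seq I (g i) * CauchySeq (eC' i))) i = x i - x (i + N)%N.
  by apply: hM => //; apply: leq_trans Mi (leq_addr _ _).
transitivity (x i - (x N + y i)); first by rewrite -valS.
by rewrite /y [x N + _]addrC subrK.
Qed.

End CompletionModuloIdeal.

(** * Completeness from a one-dimensional dual *)

Section DualOneDimensionalComplete.
Variables (R : comNzRingType) (m : idealr R) (p : prime_idealr R).
Hypotheses (R_noeth : noetherian R) (R_local : local_ring m).
Local Notation P := (p : pred R).
Local Notation m' := (m : pred R).
Local Notation D := {ideal_quot p}.
Local Notation pi := (\pi_{ideal_quot p} : {rmorphism R -> D}).
Variables (E : lmodType R) (z : E).
Hypothesis E_inj : injective_module E.
Hypothesis z0 : forall r, r *: z = 0 <-> r \in m'.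
Hypothesis z_ess : forall y : E, y != 0 ->
  exists r t, r *: y = t *: z /\ t \notin m'.
Variables (Ep : lmodType R) (u : Ep).
Hypothesis Ep_inj : injective_module Ep.
Hypothesis u0 : forall r, r *: u = 0 <-> r \in P.
Hypothesis u_ess : forall y : Ep, y != 0 ->
  exists r t, r *: y = t *: u /\ t \notin P.

Let killed (M : lmodType R) (y : M) := forall b, b \in P -> b *: y = 0.
Let pow_p n r := exists2 b, b \in ideal_pow m' n & r - b \in P.

Lemma loc_completion_residue (c : completion (loc_max p)) :
  exists (s : denom p) (a : R) (k : nat) (b : 'I_k -> R)
    (d : 'I_k -> completion (loc_max p)), (forall i, b i \in P) /\
    to_completion (loc_max p) (to_loc p (val s)) * c =
    to_completion (loc_max p) (to_loc p a) +
    \sum_i to_completion (loc_max p) (to_loc p (b i)) * d i.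
Proof.
have [k [g [gP hg]]] := noetherian_fg R_noeth (idealr_is_ideal p).
have [|r [d Ec]] := @completion_residue _ (loc_max p) k (to_loc p \o g) _ c.
  move=> r; split=> [/loc_maxP [[a s] [-> /= /hg [e ->]]]|[e ->]]; last first.
    apply: rpred_sum => i _; apply: idealMr; exact: to_loc_max.
  exists (fun i => \pi_(localization p) (1, s) * to_loc p (e i)).
  transitivity (\pi_(localization p) (1, s) * to_loc p (\sum_i e i * g i)).
    by rewrite fracM; apply: frac_eq => /=; ring.
  rewrite rmorph_sum mulr_sumr; apply: eq_bigr => i _.
  by rewrite rmorphM mulrA.
have [a [s Er]] := fracP r.
exists s, a, k, g, (fun i => to_completion (loc_max p) (to_loc p (val s)) * d i).
split=> //; rewrite Ec mulrDr -rmorphM /= Er; congr (to_completion _ _ + _).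
  by rewrite fracM; apply: frac_eq => /=; ring.
by rewrite mulr_sumr; apply: eq_bigr => i _; rewrite mulrCA.
Qed.

(** phi corresponds to 1. If f corresponds to c, then s c = a + sum b_i d_i with b_i in p, and the
    maps b_i g(d_i) vanish on elements killed by p. *)
Lemma iso_dual_dim1 :
  module_iso (module_hom Ep E)
    (restr (to_completion (loc_max p) \o to_loc p
             : {rmorphism R -> completion (loc_max p)})) ->
  exists phi : {linear Ep -> E}, forall f : {linear Ep -> E},
    exists (s : denom p) (a : R), forall y, killed y -> val s *: f y = a *: phi y.
Proof.
move=> [h [g hK gK]].
pose phi : module_hom Ep E := g (1 : completion (loc_max p)).
exists (phi : {linear Ep -> E}) => f.
have [s [a [k [b [d [Pb Ef]]]]]] := loc_completion_residue (h f).
exists s, a => y Py.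
have h_inj : injective h := can_inj hK.
have Esf : (val s *: (f : module_hom Ep E) : module_hom Ep E) =
    a *: phi + \sum_i b i *: (g (d i) : module_hom Ep E).
  apply: h_inj; rewrite linearZ linearD linearZ linear_sum /= gK.
  rewrite [LHS]Ef; congr (_ + _); first by rewrite /GRing.scale /= /restr_scale /= [RHS]mulr1.
  by apply: eq_bigr => i _; rewrite linearZ /= gK.
have sumE (I : seq 'I_k) :
    (\sum_(i <- I) b i *: (g (d i) : module_hom Ep E) : module_hom Ep E) y = 0.
  elim: I => [|i I IHI]; first by rewrite big_nil.
  rewrite big_cons -[LHS]/(b i *: g (d i) y +
    (\sum_(i <- I) b i *: (g (d i) : module_hom Ep E) : module_hom Ep E) y).
  by rewrite IHI addr0 -linearZ /= Py // linear0.
have := congr1 (fun F : module_hom Ep E => F y) Esf.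
rewrite -[LHS in LHS = _ -> _]/(val s *: f y) => ->.
by rewrite -[LHS]/(a *: phi y + _) sumE addr0.
Qed.

Variable phi : {linear Ep -> E}.
Hypothesis phi_gen : forall f : {linear Ep -> E}, exists (s : denom p) (a : R),
  forall y, killed y -> val s *: f y = a *: phi y.

(** Extend u -> e to a map f with s f = a phi on Q; then e = s f(u / s) = phi(a u / s). *)
Lemma dual_dim1_surj (e : E) : killed e -> exists2 y, killed y & phi y = e.
Proof.
move=> Pe.
have [|f fu] := extend_at E_inj (v := u) (e := e); first by move=> r /u0; apply: Pe.
have [s [a hs]] := phi_gen f.
have [u' Pu' Eu] := socle_divisible Ep_inj u0 u_ess (valP s) (killed_u u0).
exists (a *: u') => [b Pb|]; first by rewrite scalerA mulrC -scalerA Pu' ?scaler0.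
by rewrite linearZ /= -hs // -linearZ /= Eu.
Qed.

(** Lift the Cauchy sequence to r_n in R and let f extend the limit of r_n phi from Q. With s f = a
    phi on Q, the limit in R/p is a / s. *)
Lemma dual_dim1_complete : adic_complete (ideal_ext pi m').
Proof.
have pow_p_ideal n : is_ideal (pow_p n).
  exact: add_ideal_is_ideal (ideal_pow_is_ideal _ _) (idealr_is_ideal p).
have pow_pP n r : pow_p n r <-> pi r \in ideal_pow (ideal_ext pi m') n.
  by rewrite pi_in_ideal_pow.
have pow_p0 n a : a \in P -> pow_p n a.
  by move=> Pa; exists 0; rewrite ?ideal_pow_0 ?subr0.
have torsion (e : E) : killed e -> exists n, forall r, pow_p n r -> r *: e = 0.
  move=> Pe; have [n hn] := residue_torsion R_noeth z0 z_ess e; exists n => r [b mb Prb].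
  by rewrite -[r](subrK b) scalerDl Pe // hn // addr0.
have cogen := residue_cogenerator R_noeth R_local E_inj z0.
move=> d dC; have [r hr] := choice (fun n => pi_surj (d n)).
have rC n : exists N, forall i j, (N <= i)%N -> (N <= j)%N -> pow_p n (r i - r j).
  by have [N hN] := dC n; exists N => i j Ni Nj; apply/pow_pP; rewrite rmorphB -!hr; apply: hN.
have [||S [i [i_inj iP]]] := @submod_ex R Ep (fun y => killed y).
- by move=> b _; rewrite scaler0.
- move=> a x y Px Py b Pb.
  by rewrite scalerDr scalerA mulrC -scalerA Px // Py // scaler0 addr0.
have Pi w : killed (i w) by apply/iP; exists w.
have Pphi y : killed y -> killed (phi y).
  by move=> Py b Pb; rewrite -linearZ /= Py // linear0.
have [F hF] := choice (fun n => mul_linear E (r n)).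
have [|psi hpsi] := @eventually_constant_linear R S E (fun n => F n \o (phi \o i)).
  move=> w; have [n hn] := torsion _ (Pphi _ (Pi w)); have [N hN] := rC n.
  exists N => k Nk /=; rewrite !hF; apply/eqP; rewrite -subr_eq0 -scalerBl.
  by rewrite hn //; apply: hN.
have [|f hf] := @extend_factor R E E_inj S Ep i psi.
  by move=> w iw; rewrite (i_inj w 0) ?linear0.
have [s [a hs]] := phi_gen f.
have lim_s (e : E) : killed e -> exists N, forall n, (N <= n)%N -> val s *: (r n *: e) = a *: e.
  move=> Pe; have [y Py <-] := dual_dim1_surj Pe; rewrite -hs //; have /iP [w <-] := Py.
  rewrite hf; have [N hN] := hpsi w; exists N => n /hN <- /=.
  by rewrite hF.
(* If s did not divide a modulo p, some e in E_p would have s e = 0 and a e = z, against [lim_s]. *)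
have [_ [c ->] Pac] : exists2 b, (exists c, b = c * val s) & a - b \in P.
  apply: contrapT => /(cogen _ a (add_ideal_is_ideal (principal_is_ideal (val s))
    (idealr_is_ideal p))) [e [he ae]].
  have se : val s *: e = 0.
    by apply: he; exists (val s); rewrite ?subrr ?idealr0 //; exists 1; rewrite mul1r.
  have Pe : killed e.
    by move=> b Pb; apply: he; exists 0; rewrite ?subr0 //; exists 0; rewrite mul0r.
  have [N /(_ N (leqnn N))] := lim_s e Pe.
  by rewrite scalerA mulrC -scalerA se scaler0 ae => /esym; apply: residue_generator_neq0 z0.
have lim (e : E) : killed e -> exists N, forall n, (N <= n)%N -> r n *: e = c *: e.
  move=> Pe; have [y Py <-] := dual_dim1_surj Pe.
  have [y' Py' Ey] := socle_divisible Ep_inj u0 u_ess (valP s) Py.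
  have Ee : phi y = val s *: phi y' by rewrite -linearZ /= Ey.
  have [N hN] := lim_s _ (Pphi _ Py'); exists N => n /hN.
  rewrite Ee !scalerA mulrC => ->; apply/eqP; rewrite -subr_eq0 -scalerBl.
  by rewrite (Pphi _ Py').
(* Pointwise convergence on E_p becomes adic: if r j - c were outside m^n + p, an e killed by m^n +
   p would detect it, while r j and all later terms agree on e. *)
have cvg : adic_cvg (ideal_ext pi m') d (pi c).
  move=> n; have [N hN] := rC n; exists N => j Nj.
  rewrite hr -rmorphB; apply/pow_pP; apply: contrapT.
  move=> /(cogen _ _ (pow_p_ideal n)) [e [he re]]; apply: (residue_generator_neq0 z0).
  have [N' hN'] := lim e (fun b Pb => he b (pow_p0 n b Pb)).
  pose M := maxn N N'; rewrite -re -(subrKA (r M)) scalerDl.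
  rewrite [X in _ + X]scalerBl hN' ?leq_maxr // subrr addr0.
  by apply: he; apply: hN => //; apply: leq_maxl.
exists (pi c); split=> // l' cvg'; have [c' El] := pi_surj l'; rewrite El; apply/pi_eq.
(* Two limits differ by an element of every m^n + p; if it were nonzero modulo p it would act
   nontrivially on some e in E_p, yet some m^n + p kills e. *)
case: (boolP (c - c' \in P)) => // /negP cP.
have [e [Pe ce]] := cogen _ _ (idealr_is_ideal p) cP.
have [n hn] := torsion e Pe; case: (residue_generator_neq0 z0); rewrite -ce; apply: hn; apply/pow_pP.
have [N hN] := cvg n; have [N' hN'] := cvg' n.
have := ideal_powB (hN' (maxn N N') (leq_maxr _ _)) (hN (maxn N N') (leq_maxl _ _)).
by rewrite El opprB addrC addrA subrK rmorphB.
Qed.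

End DualOneDimensionalComplete.

Theorem theorem1p1 (R : comNzRingType) (m : idealr R)
    (R_noeth : noetherian R) (R_local : local_ring m)
    (p : prime_idealr R)
    (dim_p : krull_dim_eq {ideal_quot p} 1)
    (E Ep : lmodType R)
    (hullE : injective_hull (restr (\pi_{ideal_quot m} : {rmorphism R -> _})) E)
    (hullEp : injective_hull (restr (\pi_{ideal_quot p} : {rmorphism R -> _})) Ep) :
  module_iso (module_hom Ep E)
    (restr (to_completion (loc_max p) \o to_loc p
             : {rmorphism R -> completion (loc_max p)}))
  <-> adic_complete (ideal_ext (\pi_{ideal_quot p} : {rmorphism R -> _}) (m : pred R)).
Proof.
have [E_inj [z [z0 z_ess]]] := injective_hull_cyclic hullE.
have [Ep_inj [u [u0 u_ess]]] := injective_hull_cyclic hullEp.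
split=> [iso|D_complete].
  have [phi phi_gen] := iso_dual_dim1 R_noeth iso.
  exact: (dual_dim1_complete R_noeth R_local E_inj z0 z_ess Ep_inj u0 u_ess phi_gen).
have [|phi phi_u] := extend_at E_inj (v := u) (e := z).
  by move=> r /u0 Pr; apply/z0; apply: prime_sub_local R_noeth R_local _ Pr.
have nz : phi u <> 0 by rewrite phi_u; apply: residue_generator_neq0 z0.
have [act actE] := frac_action_ex (prime_hull_inj u0 u_ess) (prime_hull_surj Ep_inj u0 u_ess).
apply: (completion_iso R_noeth Ep_inj u0 u_ess actE E_inj (phi := phi)).
  by exists u => // b /u0.
exact: (socle_dual_dim1 R_noeth R_local E_inj z0 z_ess Ep_inj u0 u_ess D_complete
  dim_p (killed_u u0) nz).
Qed.
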